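(* Endow $\mathsf{PD}_{\alpha,\beta}$ with the $L^2(\mathbb{T}^d;\mathbb{R}^{d\times d})$ induced topology and let $K\subset\mathsf{PD}_{\alpha,\beta}$ be a closed set. Define the mapping $G:K\to\dot{H}^1(\mathbb{T}^d;\mathbb{R}^d)$ by $A\mapsto\chi$, where $\chi$ is the solution of the cell problem with coefficient $A$. Then there exists a bounded continuous mapping $$\mathcal{G}\in C\big(L^2(\mathbb{T}^d;\mathbb{R}^{d\times d});\dot{H}^1(\mathbb{T}^d;\mathbb{R}^d)\big)$$ such that $\mathcal{G}(A)=G(A)$ for any $A\in K$.
   Context: $\mathbb{T}^d$ is the $d$-dimensional unit torus ($1$-periodic functions). For $\beta \ge \alpha > 0$ fixed, $\mathsf{PD}_{\alpha,\beta}$ is the set of symmetric-matrix-valued $A \in L^\infty(\mathbb{T}^d;\mathbb{R}^{d\times d})$ with $\alpha|\xi|^2 \le \langle \xi, A(y)\xi\rangle \le \beta|\xi|^2$ for all $(y,\xi) \in \mathbb{T}^d\times\mathbb{R}^d$ (as usual for $L^\infty$ functions, in the almost everywhere sense in $y$). $\dot{H}^1$ denotes the space of $1$-periodic, mean-zero $W^{1,2}(\mathbb{T}^d)$ functions (componentwise for vector-valued functions), with norm $\|g\|_{\dot{H}^1} = \|\nabla g\|_{L^2}$. $L^2$ norms of matrix fields use the Frobenius norm pointwise. Cell problem: for $A \in \mathsf{PD}_{\alpha,\beta}$, $\chi \in \dot{H}^1(\mathbb{T}^d;\mathbb{R}^d)$ is the unique weak solution of $-\nabla\cdot(\nabla\chi\,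 A) = \nabla\cdot A$, $\chi$ $1$-periodic; equivalently each component satisfies $-\nabla\cdot(A\nabla\chi_\ell) = \nabla\cdot(A e_\ell)$ weakly, i.e. $\int_{\mathbb{T}^d}\langle A\nabla\chi_\ell,\nabla v\rangle\,dy = -\int_{\mathbb{T}^d}\langle Ae_\ell,\nabla v\rangle\,dy$ for all $v\in\dot{H}^1(\mathbb{T}^d;\mathbb{R})$, $\ell=1,\dots,d$, with $e_\ell$ the standard basis vectors. *)

(* Defs.v *)
From HB Require Import structures.
From mathcomp Require Import all_boot all_order all_algebra ring lra.
From mathcomp Require Import all_classical all_reals all_analysis measurable_realfun.
Set Implicit Arguments.
Unset Strict Implicit.
Unset Printing Implicit Defensive.
Import Order.TTheory GRing.Theory Num.Theory.
Import numFieldNormedType.Exports.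
Local Open Scope classical_set_scope.
Local Open Scope ring_scope.
Local Open Scope quotient_scope.

(* The separated quotient of a semi-inner-product space by the vectors of norm
   zero, as a normed module. *)
Section semi_inner.
Context (R : realType) (V : lmodType R).

Record semi_inner := SemiInner {
  sip :> V -> V -> R;
  sipC : forall x y, sip x y = sip y x;
  sipDl : forall x y z, sip (x + y) z = sip x z + sip y z;
  sipZl : forall a x z, sip (a *: x) z = a * sip x z;
  sip_ge0 : forall x, 0 <= sip x x }.

Variable b : semi_inner.

Lemma sipDr x y z : b z (x + y) = b z x + b z y.
Proof. by rewrite sipC sipDl !(sipC b z). Qed.

Lemma sipZr a x z : b z (a *: x) = a * b z x.
Proof. by rewrite sipC sipZl (sipC b z). Qed.

Lemma sip_CS x y : b x y ^+ 2 <= b x x * b y y.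
Proof.
have H (t s : R) : 0 <= t ^+ 2 * b x x + 2 * t * s * b x y + s ^+ 2 * b y y.
  have := sip_ge0 b (t *: x + s *: y).
  rewrite sipDl !sipDr !sipZl !sipZr (sipC b y x) => h.
  suff -> : t ^+ 2 * b x x + 2 * t * s * b x y + s ^+ 2 * b y y =
    t * (t * b x x) + t * (s * b x y) + (s * (t * b x y) + s * (s * b y y)) by [].
  by ring.
have Hx := sip_ge0 b x.
have [x0|xN0] := eqVneq (b x x) 0.
  have [->|xyN0] := eqVneq (b x y) 0; first by rewrite x0 mul0r expr0n.
  have := H (- (b y y + 1) / (2 * b x y)) 1.
  have -> : 2 * (- (b y y + 1) / (2 * b x y)) * 1 * b x y = - (b y y + 1).
    by field.
  rewrite x0; lra.
have := H (b x y) (- b x x).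
have -> : b x y ^+ 2 * b x x + 2 * b x y * - b x x * b x y +
   (- b x x) ^+ 2 * b y y = b x x * (b x x * b y y - b x y ^+ 2) by ring.
have xp : 0 < b x x by rewrite lt0r xN0.
by rewrite pmulr_rge0// subr_ge0.
Qed.

Definition seminorm x := Num.sqrt (b x x).

Lemma seminormZ a x : seminorm (a *: x) = `|a| * seminorm x.
Proof.
by rewrite /seminorm sipZl sipZr mulrA -expr2 sqrtrM ?sqr_ge0// sqrtr_sqr.
Qed.

Lemma seminormD x y : seminorm (x + y) <= seminorm x + seminorm y.
Proof.
rewrite -(@ler_pXn2r _ 2) ?nnegrE ?addr_ge0 ?sqrtr_ge0//.
rewrite sqrrD !sqr_sqrtr ?sip_ge0// sipDl !sipDr (sipC b y x).
have : b x y <= seminorm x * seminorm y.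
  rewrite -sqrtrM ?sip_ge0//; apply: (le_trans (ler_norm _)).
  by rewrite -sqrtr_sqr ler_wsqrtr// sip_CS.
rewrite /seminorm; lra.
Qed.

Definition seminorm_eq : rel V := fun x y => seminorm (x - y) == 0.

Let seminorm_ge0 x : 0 <= seminorm x. Proof. exact: sqrtr_ge0. Qed.

Let seminormN x : seminorm (- x) = seminorm x.
Proof. by rewrite -scaleN1r seminormZ normrN1 mul1r. Qed.

Lemma seminorm_eq0D x y : seminorm x = 0 -> seminorm y = 0 -> seminorm (x + y) = 0.
Proof.
move=> x0 y0; apply/eqP; rewrite eq_le seminorm_ge0 andbT.
by rewrite (le_trans (seminormD _ _))// x0 y0 addr0.
Qed.

Let seminorm_eq_refl : reflexive seminorm_eq.
Proof.
by move=> x; rewrite /seminorm_eq subrr -(scale0r x) seminormZ normr0 mul0r.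
Qed.

Let seminorm_eq_sym : symmetric seminorm_eq.
Proof. by move=> x y; rewrite /seminorm_eq -seminormN opprB. Qed.

Let seminorm_eq_trans : transitive seminorm_eq.
Proof.
move=> y x z /eqP xy /eqP yz; apply/eqP.
by rewrite -(subrKA y) seminorm_eq0D.
Qed.

Canonical seminorm_eq_equiv :=
  EquivRel seminorm_eq seminorm_eq_refl seminorm_eq_sym seminorm_eq_trans.

Definition hquot : Type := {eq_quot seminorm_eq}.
HB.instance Definition _ := Choice.on hquot.
HB.instance Definition _ := EqQuotient.on hquot.

Lemma hquotW (P : hquot -> Prop) :
  (forall x, P (\pi_hquot x)) -> forall x, P x.
Proof. by move=> Px x; rewrite -[x]reprK. Qed.

Lemma hquotP x y : reflect (\pi_hquot x = \pi_hquot y) (seminorm (x - y) == 0).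
Proof.
have <- : (x == y %[mod hquot]) = (seminorm (x - y) == 0) by rewrite eqmodE.
exact: eqP.
Qed.

Lemma hquot_reprK x : seminorm (repr (\pi_hquot x) - x) = 0.
Proof. by apply/eqP/hquotP; rewrite reprK. Qed.

Let add (x y : hquot) : hquot := \pi_hquot (repr x + repr y).
Let opp (x : hquot) : hquot := \pi_hquot (- repr x).
Let scale (a : R) (x : hquot) : hquot := \pi_hquot (a *: repr x).

Let addE x y : add (\pi_hquot x) (\pi_hquot y) = \pi_hquot (x + y).
Proof.
apply/hquotP/eqP; rewrite opprD addrACA.
by apply: seminorm_eq0D; exact: hquot_reprK.
Qed.

Let oppE x : opp (\pi_hquot x) = \pi_hquot (- x).
Proof. by apply/hquotP/eqP; rewrite -opprD seminormN hquot_reprK. Qed.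

Let scaleE a x : scale a (\pi_hquot x) = \pi_hquot (a *: x).
Proof.
by apply/hquotP/eqP; rewrite -scalerBr seminormZ hquot_reprK mulr0.
Qed.

Let addA : associative add.
Proof. by elim/hquotW=> x; elim/hquotW=> y; elim/hquotW=> z; rewrite !addE addrA. Qed.

Let addC : commutative add.
Proof. by elim/hquotW=> x; elim/hquotW=> y; rewrite !addE addrC. Qed.

Let add0 : left_id (\pi_hquot 0) add.
Proof. by elim/hquotW=> x; rewrite addE add0r. Qed.

Let addN : left_inverse (\pi_hquot 0) opp add.
Proof. by elim/hquotW=> x; rewrite oppE addE addNr. Qed.

HB.instance Definition _ := GRing.isZmodule.Build hquot addA addC add0 addN.

Lemma hquot_piD x y : \pi_hquot (x + y) = \pi_hquot x + \pi_hquot y.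
Proof. by rewrite -addE. Qed.

Let scaleA a c v : scale a (scale c v) = scale (a * c) v.
Proof. by elim/hquotW: v => x; rewrite !scaleE scalerA. Qed.

Let scale1 : left_id 1 scale.
Proof. by elim/hquotW=> x; rewrite scaleE scale1r. Qed.

Let scaleDr : right_distributive scale +%R.
Proof.
move=> a; elim/hquotW=> x; elim/hquotW=> y.
by rewrite -hquot_piD !scaleE scalerDr hquot_piD.
Qed.

Let scaleDl v : {morph scale^~ v : a c / a + c}.
Proof.
by move=> a c; elim/hquotW: v => x; rewrite !scaleE scalerDl hquot_piD.
Qed.

HB.instance Definition _ :=
  GRing.Zmodule_isLmodule.Build R hquot scaleA scale1 scaleDr scaleDl.

Lemma hquot_piZ a x : \pi_hquot (a *: x) = a *: \pi_hquot x.
Proof. by rewrite -scaleE. Qed.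

Let norm (x : hquot) := seminorm (repr x).

Let normE x : norm (\pi_hquot x) = seminorm x.
Proof.
have h u v : seminorm (u - v) = 0 -> seminorm u <= seminorm v.
  by move=> uv; rewrite -[u](subrK v) (le_trans (seminormD _ _))// uv add0r.
apply/eqP; rewrite eq_le !h//; last exact: hquot_reprK.
by rewrite -seminormN opprB hquot_reprK.
Qed.

Let normD x y : norm (x + y) <= norm x + norm y.
Proof.
by elim/hquotW: x => x; elim/hquotW: y => y; rewrite -hquot_piD !normE seminormD.
Qed.

Let normZ a x : norm (a *: x) = `|a| * norm x.
Proof. by elim/hquotW: x => x; rewrite -hquot_piZ !normE seminormZ. Qed.

Let norm_eq0 x : norm x = 0 -> x = 0.
Proof.
elim/hquotW: x => x; rewrite normE => x0.
by apply/hquotP; rewrite subr0 x0.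
Qed.

HB.instance Definition _ :=
  @Lmodule_isNormed.Build R hquot norm normD normZ norm_eq0.

Lemma hquot_normE x : `|\pi_hquot x| = seminorm x.
Proof. exact: normE. Qed.

End semi_inner.

Section torus.
Context (R : realType).

Definition tcons n (x : measurableTypeR R * n.-tuple (measurableTypeR R)) :
  n.+1.-tuple (measurableTypeR R) := [tuple of x.1 :: x.2].

Lemma measurable_tcons n : measurable_fun [set: _] (@tcons n).
Proof. exact: measurable_cons. Qed.

HB.instance Definition _ n :=
  isMeasurableFun.Build _ _ _ _ (@tcons n) (@measurable_tcons n).

Definition unif01 : probability (measurableTypeR R) R :=
  uniform_prob (@ltr01 R).

(* The space L^2 of the torus R^d / Z^d is that of the unit cube: functions
   live on d-tuples of reals and only their values on [0, 1]^d, which carries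
   all the mass of [torus_measure], matter. *)
Fixpoint torus_measure d : probability (d.-tuple (measurableTypeR R)) R :=
  if d is n.+1 then distribution (unif01 \x torus_measure n)%E (@tcons n)
  else \d_([tuple]).

End torus.

Section L2.
Context (R : realType) (d m n : nat).
Notation T := (d.-tuple (measurableTypeR R)).
Notation mu := (torus_measure R d).

Let le12 : (1 <= 2%:E :> \bar R)%E. Proof. by rewrite lee_fin ler1n. Qed.

Definition L2_pred : {pred T -> 'M[R]_(m, n)} :=
  fun A : T -> 'M[R]_(m, n) => `[< forall i j, (fun y => A y i j) \in Lfun mu 2%:E >].

Lemma L2_predP (A : T -> 'M[R]_(m, n)) : reflect (forall i j, (fun y => A y i j) \in Lfun mu 2%:E)
  (A \in L2_pred).
Proof. exact: asboolP. Qed.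

Lemma L2_submod_closed : submod_closed L2_pred.
Proof.
have [h0 hD] := Lfun_submod_closed mu le12.
split=> [|a A B /L2_predP hA /L2_predP hB]; apply/L2_predP => i j.
  by rewrite (_ : (fun _ => _) = 0)//; apply/funext => y; rewrite mxE.
rewrite (_ : (fun _ => _) = a *: (fun y => A y i j) + (fun y => B y i j)).
  exact: hD.
by apply/funext => y; rewrite !mxE.
Qed.

HB.instance Definition _ :=
  GRing.isSubmodClosed.Build R (T -> 'M[R]_(m, n)) L2_pred L2_submod_closed.

Record L2field := { L2fun :> T -> 'M[R]_(m, n); L2funP : L2fun \in L2_pred }.

HB.instance Definition _ := [isSub for L2fun].
HB.instance Definition _ := [Choice of L2field by <:].
HB.instance Definition _ := [SubChoice_isSubLmodule of L2field by <:].

Lemma L2_entry (A : L2field) i j : (fun y => A y i j) \in Lfun mu 2%:E.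
Proof. by case: A => A /= /L2_predP. Qed.

Definition frobenius_prod (M N : 'M[R]_(m, n)) := \sum_i \sum_j M i j * N i j.

Definition L2_prod (A B : L2field) := \int[mu]_y frobenius_prod (A y) (B y).

Let integrable_prod (A B : L2field) :
  mu.-integrable setT (EFin \o (fun y => frobenius_prod (A y) (B y))).
Proof.
rewrite [X in _.-integrable _ X](_ : _ =
  (fun y => \sum_i \sum_j (A y i j * B y i j)%:E)%E); last first.
  apply/funext => y /=; rewrite /frobenius_prod -sumEFin.
  by apply: eq_bigr => i _; rewrite -sumEFin.
apply: integrable_sum => // i _; apply: integrable_sum => // j _.
apply/Lfun1_integrable.
exact: (Lfun2_mul_Lfun1 (L2_entry A i j) (L2_entry B i j)).
Qed.

Let prodC A B : L2_prod A B = L2_prod B A.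
Proof.
apply: eq_Rintegral => y _; apply: eq_bigr => i _; apply: eq_bigr => j _.
by rewrite mulrC.
Qed.

Let prodDl A B C : L2_prod (A + B) C = L2_prod A C + L2_prod B C.
Proof.
rewrite /L2_prod -RintegralD//; try exact: integrable_prod.
apply: eq_Rintegral => y _; rewrite /frobenius_prod -big_split; apply: eq_bigr => i _.
by rewrite -big_split; apply: eq_bigr => j _; rewrite /= mxE mulrDl.
Qed.

Let prodZl a A B : L2_prod (a *: A) B = a * L2_prod A B.
Proof.
rewrite /L2_prod -RintegralZl//; try exact: integrable_prod.
apply: eq_Rintegral => y _; rewrite /frobenius_prod mulr_sumr; apply: eq_bigr => i _.
by rewrite mulr_sumr; apply: eq_bigr => j _; rewrite /= mxE mulrA.
Qed.

Let prod_ge0 A : 0 <= L2_prod A A.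
Proof.
apply: Rintegral_ge0 => // y _.
by apply: sumr_ge0 => i _; apply: sumr_ge0 => j _; rewrite -expr2 sqr_ge0.
Qed.

Definition L2_inner : semi_inner L2field := SemiInner prodC prodDl prodZl prod_ge0.

(* Two fields are identified iff the L^2 norm of the pointwise Frobenius norm
   of their difference vanishes, i.e. iff they are equal almost everywhere. *)
Definition L2 := hquot L2_inner.
HB.instance Definition _ := NormedModule.on L2.

End L2.

Section smooth.
Context (R : realType) (d : nat).
Notation T := (d.-tuple (measurableTypeR R)).
Notation mu := (torus_measure R d).
Implicit Types (phi : 'rV[R]_d -> R) (s : seq 'I_d).

(* Matrices, unlike tuples, have a normed space structure, so that functions
   on R^d to be differentiated are defined on row vectors. *)
Definition torus_point (y : T) : 'rV[R]_d := \row_i tnth y i.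

Definition torus_periodic phi := forall x i, phi (x + delta_mx 0 i) = phi x.

Fixpoint iter_partial s phi : 'rV[R]_d -> R :=
  if s is i :: s' then 'D_(delta_mx 0 i) (iter_partial s' phi) else phi.

(* all the iterated partial derivatives exist and are continuous *)
Definition smooth phi := forall s, continuous (iter_partial s phi) /\
  forall i x, derivable (iter_partial s phi) x (delta_mx 0 i).

Lemma measurable_point phi : continuous phi ->
  measurable_fun [set: T] (phi \o torus_point).
Proof.
move=> cphi.
pose g (k : nat) (y : T) : 'rV[int]_d :=
  \row_i Num.floor (k.+1%:R * (tnth y i : R)).
pose q (k : nat) (z : 'rV[int]_d) : 'rV[R]_d := \row_i ((z 0 i)%:~R / k.+1%:R).
apply: (@measurable_fun_cvg _ T R setT (fun k => phi \o q k \o g k)).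
  move=> k _ Y mY; rewrite setTI.
  rewrite (_ : _ @^-1` Y = \bigcup_(z : 'rV[int]_d)
      ([set y | g k y = z] `&` [set y | Y (phi (q k z))])); last first.
    apply/seteqP; split=> [y /= Yy|y [z _ [/= <-]]//].
    by exists (g k y).
  apply: countable_bigcupT_measurable => [|z]; first exact: countableP.
  have [Yz|nYz] := pselect (Y (phi (q k z))); last first.
    by rewrite (_ : _ `&` _ = set0)//; apply/seteqP; split=> // y [].
  rewrite (_ : _ `&` _ = \bigcap_(i in [set: 'I_d])
     ((fun y : T => tnth y i) @^-1`
       `[(z 0 i)%:~R / k.+1%:R : R, (z 0 i + 1)%:~R / k.+1%:R[%classic)).
    apply: fin_bigcap_measurable; first exact: finite_finset.
    move=> i _; rewrite -[X in measurable X]setTI.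
    exact: (measurable_tnth i measurableT (measurable_itv _)).
  have k0 : 0 < k.+1%:R :> R by rewrite ltr0n.
  have fl (i : 'I_d) (y : T) : (g k y 0 i == z 0 i) =
    ((tnth y i : R) \in `[(z 0 i)%:~R / k.+1%:R : R, (z 0 i + 1)%:~R / k.+1%:R[).
    by rewrite mxE in_itv/= ler_pdivrMr// ltr_pdivlMr// mulrC floor_eq.
  apply/seteqP; split=> [y [/= gz _] i _|y yz]; rewrite /=.
    by rewrite -fl gz.
  split=> //; apply/rowP => i; apply/eqP; rewrite fl; exact: yz.
move=> y _; apply: (@cvg_comp _ _ _ (fun k => q k (g k y)) phi _ (nbhs (torus_point y))); last exact: cphi.
apply/cvg_ballP => e e0.
near=> k; split=> // i j; rewrite /ball/= !mxE.
have k0 : 0 < k.+1%:R :> R by rewrite ltr0n.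
set t : R := tnth y j.
have := floor_itv (k.+1%:R * t) => /andP[f1 f2].
have : 0 <= t - (Num.floor (k.+1%:R * t))%:~R / k.+1%:R < e.
  rewrite subr_ge0 ler_pdivrMr// (mulrC t) f1/=.
  rewrite ltrBlDr -ltrBlDl ltr_pdivlMr//.
  rewrite intrD in f2.
  have : 1 <= e * k.+1%:R.
    rewrite -ler_pdivrMr// mul1r ltW//; near: k.
    exact: (near_infty_natSinv_lt (PosNum e0)).
  rewrite mulrBl (mulrC t); lra.
by move=> /andP[t0 te]; rewrite ger0_norm.
Unshelve. all: by end_near. Qed.


Lemma periodic_partial phi i : torus_periodic phi -> torus_periodic ('D_(delta_mx 0 i) phi).
Proof.
move=> per x j; rewrite /derive; set F := (X in lim (X @ _)); set G := (X in _ = lim (X @ _)).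
suff -> : F = G by [].
by apply/funext => h; rewrite /F /G /= !per addrA per.
Qed.

Lemma periodic_iter_partial s phi : torus_periodic phi -> torus_periodic (iter_partial s phi).
Proof. by move=> per; elim: s => //= i s; exact: periodic_partial. Qed.

Lemma periodic_int phi (z : 'rV[int]_d) x : torus_periodic phi ->
  phi (x + map_mx intr z) = phi x.
Proof.
move=> per.
have pern i (k : nat) y : phi (y + delta_mx 0 i *+ k) = phi y.
  by elim: k y => [|k ih] y; rewrite ?mulr0n ?addr0// mulrSr addrA per.
have perz i (k : int) y : phi (y + delta_mx 0 i *~ k) = phi y.
  case: k => k; first exact: pern.
  by rewrite NegzE mulrNz -[LHS](pern i k.+1) subrK.
rewrite [map_mx _ _]row_sum_delta.
elim/big_ind: _ (x) => [y|u v hu hv y|i _ y]; first by rewrite addr0.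
  by rewrite addrA hv hu.
by rewrite mxE scaler_int perz.
Qed.

Lemma periodic_bounded phi : continuous phi -> torus_periodic phi ->
  exists M, forall x, `|phi x| <= M.
Proof.
move=> cphi per.
pose C := [set v : 'rV[R]_d | forall i, `[0, 1]%classic (v 0 i)].
have cC : compact C by apply: (@rV_compact R d (fun=> `[0, 1]%classic)) => i; exact: segment_compact.
have : compact (phi @` C).
  by apply: continuous_compact => //; apply: continuous_subspaceT.
move=> /compact_bounded[M [_ /(_ (M + 1))]].
rewrite ltrDl ltr01 => /(_ isT) bM; exists (M + 1) => x.
pose z : 'rV[int]_d := \row_i - Num.floor (x 0 i).
rewrite -(periodic_int z x per); apply: bM; exists (x + map_mx intr z) => // i.
have := floor_itv (x 0 i); rewrite intrD => /andP[f1 f2].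
rewrite !mxE /= in_itv/= rmorphN/= subr_ge0 f1/= lerBlDr addrC.
exact: ltW.
Qed.

Lemma smooth_Lfun phi s : smooth phi -> torus_periodic phi ->
  (iter_partial s phi \o torus_point) \in Lfun mu 2%:E.
Proof.
move=> sphi per; have [cs _] := sphi s.
have [M bM] := periodic_bounded cs (periodic_iter_partial s per).
have ms := measurable_point cs.
have := Lfun_cst mu M 2; rewrite !inE => /andP[_]; rewrite inE /finite_norm => Mfin.
apply/andP; split; rewrite inE//= /finite_norm.
apply: le_lt_trans Mfin; rewrite unlock; apply: gt0_ler_poweR => //.
- by rewrite in_itv/= leey integral_ge0// => y _; exact: poweR_ge0.
- by rewrite in_itv/= leey integral_ge0// => y _; exact: poweR_ge0.
apply: ge0_le_integral => //.
- by move=> y _; exact: poweR_ge0.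
- apply/measurable_EFinP/(@measurableT_comp _ _ _ _ _ _ (@powR R ^~ 2)) => //.
  exact: measurableT_comp.
- exact: (measurable_cst (`|M%:E| `^ 2)%E).
- move=> y _; apply: gt0_ler_poweR; rewrite ?in_itv/= ?leey ?andbT ?abse_ge0//.
  by rewrite lee_fin (le_trans (bM _))// ler_norm.
Qed.

End smooth.

Section H1.
Context (R : realType) (d k : nat).
Notation T := (d.-tuple (measurableTypeR R)).
Notation mu := (torus_measure R d).

Definition mean_zero (u : T -> 'cV[R]_k) :=
  forall l, \int[mu]_y u y l 0 = 0.

Definition weak_gradient (u : T -> 'cV[R]_k) (g : T -> 'M[R]_(k, d)) :=
  forall (phi : 'rV[R]_d -> R), smooth phi -> torus_periodic phi ->
  forall (l : 'I_k) (j : 'I_d),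
    \int[mu]_y (u y l 0 * 'D_(delta_mx 0 j) phi (torus_point y)) =
    - \int[mu]_y (g y l j * phi (torus_point y)).

(* A W^{1,2} function is a pair (u, g) of L^2 fields, g being the weak gradient
   of u (unique a.e.): g y l j is the j-th partial derivative of u_l at y. *)
Definition H1_pred : {pred L2field R d k 1 * L2field R d k d} :=
  fun u : L2field R d k 1 * L2field R d k d =>
    `[< mean_zero u.1 /\ weak_gradient u.1 u.2 >].

Let integrable_test m n (u : L2field R d m n) i j phi s :
  smooth phi -> torus_periodic phi ->
  mu.-integrable setT
    (EFin \o (fun y => u y i j * iter_partial s phi (torus_point y))).
Proof.
move=> sphi per; apply/Lfun1_integrable.
exact: (Lfun2_mul_Lfun1 (L2_entry u i j) (smooth_Lfun s sphi per)).
Qed.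

Let integrable_entry m n (u : L2field R d m n) i j :
  mu.-integrable setT (EFin \o (fun y => u y i j)).
Proof.
apply/Lfun1_integrable.
rewrite (_ : (fun y => _) = (fun y => u y i j) \* cst 1); last first.
  by apply/funext => y /=; rewrite mulr1.
exact: (Lfun2_mul_Lfun1 (L2_entry u i j) (Lfun_cst _ 1 2)).
Qed.

Let Rintegral0 : \int[mu]_y (0 : R) = 0.
Proof. by rewrite /Rintegral integral0. Qed.

Let integrable_scale (a : R) (f : T -> R) :
  mu.-integrable setT (EFin \o f) ->
  mu.-integrable setT (EFin \o (fun y => a * f y)).
Proof. exact: integrableZl. Qed.

Lemma H1_submod_closed : submod_closed H1_pred.
Proof.
split.
  apply/asboolP; split=> [l|phi _ _ l j].
    under eq_Rintegral do rewrite mxE.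
    by rewrite Rintegral0.
  under eq_Rintegral do rewrite mxE mul0r.
  under [in RHS]eq_Rintegral do rewrite mxE mul0r.
  by rewrite Rintegral0 oppr0.
move=> a [u g] [v h] /asboolP[/= u0 ug] /asboolP[/= v0 vh].
apply/asboolP; split=> [l|phi sphi per l j] /=.
  under eq_Rintegral do rewrite !mxE.
  have du := integrable_entry u l 0; have dv := integrable_entry v l 0.
  rewrite RintegralD//; try exact: integrable_scale.
  by rewrite RintegralZl//= u0 v0 mulr0 addr0.
have du := integrable_test u l 0 [:: j] sphi per.
have dv := integrable_test v l 0 [:: j] sphi per.
have dg := integrable_test g l j [::] sphi per.
have dh := integrable_test h l j [::] sphi per.
under eq_Rintegral do rewrite !mxE mulrDl -mulrA.
under [in RHS]eq_Rintegral do rewrite !mxE mulrDl -mulrA.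
rewrite !RintegralD//; try exact: integrable_scale.
by rewrite !RintegralZl// ug// vh// mulrN opprD.
Qed.

HB.instance Definition _ :=
  GRing.isSubmodClosed.Build R (L2field R d k 1 * L2field R d k d)%type H1_pred
    H1_submod_closed.

Record H1field := {
  H1pair : L2field R d k 1 * L2field R d k d; H1pairP : H1pair \in H1_pred }.

HB.instance Definition _ := [isSub for H1pair].
HB.instance Definition _ := [Choice of H1field by <:].
HB.instance Definition _ := [SubChoice_isSubLmodule of H1field by <:].

(* so that the seminorm is the L^2 norm of the gradient *)
Definition H1_prod (u v : H1field) : R :=
  L2_inner R d k d (H1pair u).2 (H1pair v).2.

Let prodC u v : H1_prod u v = H1_prod v u.
Proof. exact: sipC. Qed.

Let prodDl u v w : H1_prod (u + v) w = H1_prod u w + H1_prod v w.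
Proof. exact: sipDl. Qed.

Let prodZl a u v : H1_prod (a *: u) v = a * H1_prod u v.
Proof. exact: sipZl. Qed.

Let prod_ge0 u : 0 <= H1_prod u u.
Proof. exact: sip_ge0. Qed.

Definition H1_inner : semi_inner H1field := SemiInner prodC prodDl prodZl prod_ge0.

(* On mean-zero functions the gradient seminorm of u - v vanishes iff u = v
   almost everywhere, so this is the usual identification. *)
Definition Hdot1 := hquot H1_inner.
HB.instance Definition _ := NormedModule.on Hdot1.

Definition hgrad (u : Hdot1) : T -> 'M[R]_(k, d) := (H1pair (repr u)).2.

End H1.

Section cell_problem.
Context (R : realType) (d : nat).
Notation T := (d.-tuple (measurableTypeR R)).
Notation mu := (torus_measure R d).

Definition L2repr m n (A : L2 R d m n) : T -> 'M[R]_(m, n) := repr A.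

Definition dotp (x y : 'cV[R]_d) : R := (x^T *m y) 0 0.

(* Coefficients are taken as elements of L^2, which contains L^oo since the
   torus has finite measure, in view of the topology they are endowed with. *)
Definition PD (alpha beta : R) : set (L2 R d d d) :=
  [set A | (forall i j, finite_norm mu +oo%E (fun y => L2repr A y i j)) /\
    \forall y \ae mu, (L2repr A y)^T = L2repr A y /\
      forall xi : 'cV[R]_d,
        alpha * dotp xi xi <= dotp xi (L2repr A y *m xi) <= beta * dotp xi xi].

(* weak form of  - div (A grad chi_l) = div (A e_l)  for every l *)
Definition cell_solution (A : L2 R d d d) (chi : Hdot1 R d d) :=
  forall (l : 'I_d) (v : Hdot1 R d 1),
    \int[mu]_y dotp (L2repr A y *m (row l (hgrad chi y))^T) (row 0 (hgrad v y))^T =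
    - \int[mu]_y dotp (L2repr A y *m delta_mx l 0) (row 0 (hgrad v y))^T.

End cell_problem.

(* Main.v *)
(* The solution map is continuous on K. If chi and chi' solve the cell problems
   for A and B, then testing with chi' - chi and using the ellipticity of B give
     alpha |grad (chi'_l - chi_l)|_2 <= |(B - A) (e_l + grad chi_l)|_2 .
   Along a sequence B_k -> A with |B_k - A|_2^2 <= 2^-k one has B_k -> A almost
   everywhere, and as the matrices are uniformly bounded the right-hand side
   tends to 0 by dominated convergence; e_l + grad chi_l being only square
   integrable, no Lipschitz bound is available. The same test gives a uniform
   bound on chi.
   As PD is closed in L^2, so is K, and Dugundji's theorem extends the map with
   values in the convex hull of its range. The extension is
     F x = (sum_n psi_n x)^-1 *: sum_n psi_n x *: f (s_n x)    (x notin K)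
   where the sum is locally finite and s_n x is an almost nearest point of K,
   locally independent of x. The functions psi_n come from Stone's theorem in
   Rudin's form: the points of K are well-ordered, and each x is assigned to the
   first of those which remain almost nearest in a ball around x. Since the sum
   is locally finite, the completeness of the target space is not needed. *)
Require Import Defs.
From mathcomp Require Import all_boot all_order all_algebra ring lra.
From mathcomp Require Import all_classical all_reals all_analysis measurable_realfun.
From mathcomp Require Import wochoice ess_sup_inf.
Set Implicit Arguments.
Unset Strict Implicit.
Unset Printing Implicit Defensive.
Import Order.TTheory GRing.Theory Num.Theory.
Import numFieldNormedType.Exports.
Local Open Scope classical_set_scope.
Local Open Scope ring_scope.

(** * Dugundji's extension theorem *)

Section bump.
Context (R : realType) (X : normedModType R).
Implicit Types (c : R) (E : set X) (x y : X).

(** The positive part of c minus the distance from x to [E]. The 0 in the supremum provides the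
    truncation and the value for empty [E]. *)
Definition bump c E x : R := sup (0 |` [set c - `|x - e| | e in E]).

Let bump_has_sup c E x : 0 <= c -> has_sup (0 |` [set c - `|x - e| | e in E]).
Proof.
move=> c0; split; first by exists 0; left.
by exists c => _ [->//|[e _ <-]]; rewrite lerBlDr lerDl.
Qed.

Lemma bump_ge0 c E x : 0 <= c -> 0 <= bump c E x.
Proof. by move=> c0; apply: sup_ubound; [case: (bump_has_sup E x c0)|left]. Qed.

Lemma bump_ge c E x e : 0 <= c -> E e -> c - `|x - e| <= bump c E x.
Proof.
by move=> c0 Ee; apply: sup_ubound; [case: (bump_has_sup E x c0)|right; exists e].
Qed.

Lemma bump_le c E x : 0 <= c -> bump c E x <= c.
Proof.
move=> c0; apply: ge_sup; first by exists 0; left.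
by move=> _ [->//|[e _ <-]]; rewrite lerBlDr lerDl.
Qed.

Lemma bump_gt0 c E x : 0 <= c -> 0 < bump c E x -> exists2 e, E e & `|x - e| < c.
Proof.
move=> c0 b0; have [_ [->|[e Ee <-]]] := sup_adherent b0 (bump_has_sup E x c0).
  by rewrite subrr ltxx.
by rewrite subrr subr_gt0 => ?; exists e.
Qed.

Lemma bump_lip c E x y : 0 <= c -> bump c E x <= bump c E y + `|x - y|.
Proof.
move=> c0; apply: ge_sup; first by exists 0; left.
move=> _ [->|[e Ee <-]]; first by rewrite addr_ge0// bump_ge0.
have := bump_ge y c0 Ee; have := ler_distD x y e; rewrite (distrC y x); lra.
Qed.

Lemma bump_continuous c E : 0 <= c -> continuous (bump c E).
Proof.
move=> c0 x; apply/cvgrPdist_lt => e e0.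
near=> y.
have yx : `|x - y| < e by near: y; apply: (@cvgr_dist_lt _ X _ _ _ id).
have := bump_lip E x y c0; have := bump_lip E y x c0; rewrite (distrC y x) => h1 h2.
rewrite ltr_norml; apply/andP; split; lra.
Unshelve. all: by end_near. Qed.

End bump.

(** * Stone-type weights off a closed set *)

Section partition.
Context (R : realType) (X : normedModType R) (K : set X).
Hypotheses (K_closed : closed K) (K_neq0 : K !=set0).

(** The distance to [K] need not be attained; the factor 3 also leaves room for one a to serve a
    whole ball of points y. *)
Definition almost_nearest a y := forall b, K b -> `|y - a| <= 3 * `|y - b|.

Let inner_nearest a x :=
  K a /\ exists2 r : R, 0 < r & forall y, `|x - y| < r -> almost_nearest a y.

Let ex_inner_nearest x : ~ K x -> exists a, inner_nearest a x.
Proof.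
move=> nKx.
have /nbhs_ballP[r /= r0 br] : nbhs x (~` K).
  by apply: open_nbhs_nbhs; split=> //; exact: closed_openC.
have rK b : K b -> r <= `|x - b|.
  by move=> Kb; rewrite leNgt; apply/negP => h; apply: (br b) => //; rewrite -ball_normE.
pose D := [set `|x - b| | b in K].
have hD : has_inf D.
  split; first by case: K_neq0 => b Kb; exists `|x - b|, b.
  by exists 0 => _ [b _ <-].
have rD : r <= inf D by apply: lb_le_inf; [case: hD|move=> _ [b Kb <-]; exact: rK].
have D0 : 0 < inf D by exact: lt_le_trans rD.
have [_ [a Ka <-] ha] := inf_adherent D0 hD.
(* As |x - a| < 2 inf D and r <= |x - b|, each y with |x - y| < r/4 has |y - a| <= 2|x - b| + r/4 <=
   3(|x - b| - r/4) <= 3|y - b|. *)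
exists a; split=> //; exists (r / 4); first by rewrite divr_gt0.
move=> y xy b Kb.
have h1 : inf D <= `|x - b| by apply: ge_inf; [case: hD|exists b].
have := rK b Kb; have := ler_distD x y a; have := ler_distD y x b.
rewrite (distrC y x); lra.
Qed.

Let wo : {le : rel X | well_order le} := well_ordering_principle X.

Let ex_first x : exists a, ~ K x -> inner_nearest a x /\
  forall b, inner_nearest b x -> sval wo a b.
Proof.
have [Kx|nKx] := pselect (K x); first by exists x.
have [a ha] := ex_inner_nearest nKx.
have [|z [[/asboolP zI zm] _]] := svalP wo (fun a => `[< inner_nearest a x >]).
  by exists a; apply/asboolP.
exists z => _; split=> // b bI; apply: zm; exact/asboolP.
Qed.

Let first x : X := sval (cid (ex_first x)).

Let firstP x : ~ K x -> inner_nearest (first x) x.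
Proof. by move=> nKx; have [] := svalP (cid (ex_first x)) nKx. Qed.

Let first_le x b : ~ K x -> inner_nearest b x -> sval wo (first x) b.
Proof. by move=> nKx; have [_] := svalP (cid (ex_first x)) nKx; exact. Qed.

Let wo_anti : antisymmetric (sval wo).
Proof.
move=> x y; apply: (@wo_chain_antisymmetric _ _ predT) => //.
exact: withinW (svalP wo).
Qed.

(** Here 8 * c n = 1/(n+1): the index of a point of [E n] works on a ball eight times wider than the
    reach of the bump, a margin spent in the triangle inequalities below. *)
Let c (n : nat) : R := n.+1%:R^-1 / 8.

Let c_gt0 n : 0 < c n. Proof. by rewrite divr_gt0// invr_gt0 ltr0n. Qed.
Let c_ge0 n : 0 <= c n. Proof. exact: ltW. Qed.

Let E n := [set x | ~ K x /\ forall y, `|x - y| < 8 * c n -> almost_nearest (first x) y].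

(* Nearby points of one layer share their first index: each index is
   admissible at the other point, so each is below the other in the order. *)
Let E_first n x y : E n x -> E n y -> `|x - y| < 4 * c n -> first x = first y.
Proof.
have H u v : E n u -> E n v -> `|u - v| < 4 * c n ->
    sval wo (first v) (first u).
  move=> [nKu Eu] [nKv Ev] uv; apply: first_le => //.
  split; first by case: (firstP nKu).
  exists (4 * c n) => [|w vw]; first by rewrite mulr_gt0.
  by apply: Eu; have := ler_distD v u w; lra.
by move=> Ex Ey xy; apply: wo_anti; rewrite !H// distrC.
Qed.

Let Phi n := bump (c n) (E n).

(* Subtracting the earlier bumps with a growing weight makes the family locally
   finite without losing the first bump that is positive at a given point. *)
Let psi n x := Num.max 0 (Phi n x - n%:R * \sum_(i < n) Phi i x).

Let psi_gt0 n x : 0 < psi n x -> 0 < Phi n x.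
Proof.
rewrite /psi lt_max ltxx /= => h; apply: lt_le_trans h _.
by rewrite lerBlDr lerDl mulr_ge0// sumr_ge0// => i _; exact: bump_ge0.
Qed.

(** Two points of [E n] within [c n] of x are less than 4 * c n apart, so by [E_first] the index
    does not depend on the point picked. The default 0 occurs only where [psi n] vanishes. *)
Let sel n x : X := first (xget 0 [set e | E n e /\ `|x - e| < c n]).

Let selP n x : 0 < psi n x -> exists e, [/\ E n e, `|x - e| < c n & sel n x = first e].
Proof.
move=> /psi_gt0/(bump_gt0 (c_ge0 n))[e Ee xe]; rewrite /sel.
by case: xgetP => [e' _ [? ?]|/(_ e)]; [exists e'|case].
Qed.

Let ex_Phi_gt0 x : ~ K x -> exists n, 0 < Phi n x.
Proof.
move=> nKx; have [_ [r r0 hr]] := firstP nKx.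
(* A radius 1/(n+1) below r puts x itself in [E n]. *)
have [n _ nr] := near_infty_natSinv_lt (PosNum r0).
exists n; apply: (@lt_le_trans _ _ (c n - `|x - x|)).
  by rewrite subrr normr0 subr0.
apply: bump_ge => //; split=> // y xy; apply: hr; apply: lt_trans xy _.
by rewrite /c mulrC divfK// nr//=.
Qed.

(** The weights are not normalised; [barycenter] divides by their sum. The last clause is what
    continuity off [K] rests on. *)
Lemma ex_partition : exists (psi : nat -> X -> R) (s : nat -> X -> X),
  [/\ (forall n x, 0 <= psi n x) /\ forall n, continuous (psi n),
      forall x : X, ~ K x -> exists N, \forall y \near x, forall n, (N <= n)%N -> psi n y = 0,
      forall x, ~ K x -> exists n, 0 < psi n x,
      forall n x, 0 < psi n x -> K (s n x) /\ almost_nearest (s n x) x &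
      forall n (x : X), exists a, \forall y \near x, 0 < psi n y -> s n y = a].
Proof.
have cPhi n : continuous (Phi n) by exact: bump_continuous.
exists psi, sel; split.
- split=> [n x|n x]; first by rewrite /psi le_max lexx.
  apply: (@continuous_max R X (cst 0) (fun x => Phi n x - n%:R * \sum_(i < n) Phi i x)) => y.
    exact: cst_continuous.
  apply: cvgB; first exact: cPhi.
  by apply: cvgMl_tmp; apply: cvg_big => [|i _]; [exact: add_continuous|exact: cPhi].
- move=> x /ex_Phi_gt0[k k0].
  have [N1 _ hN1] := near_infty_natSinv_lt (PosNum (divr_gt0 k0 (ltr0n _ 2))).
  (* Near x the bump k stays above half its value at x. Once 1/(n+1) is below that half and k < n +
     1, the term subtracted at index n + 1 exceeds 1, hence the bump. The successor excludes index
     0, where the subtracted term has weight 0. *)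
  exists (N1 + k).+1; near=> y => -[//|n] Nn.
  have Pky : Phi k x / 2 < Phi k y.
    near: y; apply: (cvgr_gt (Phi k x)); [exact: cPhi|].
    by rewrite gtr_pMr// invf_lt1// ltr1n.
  rewrite /psi max_l// subr_le0 (le_trans (bump_le _ _ (c_ge0 n.+1)))//.
  have kn : (k < n.+1)%N by rewrite (leq_trans _ Nn)// ltnS leq_addl.
  rewrite (bigD1 (Ordinal kn))//= mulrDr -[c n.+1]addr0 lerD//; last first.
    by rewrite mulr_ge0// sumr_ge0// => i _; exact: bump_ge0.
  have h : n.+1%:R^-1 < Phi k x / 2.
    by apply: hN1; rewrite /= -ltnS (leq_ltn_trans _ Nn)// leq_addr.
  apply: (@le_trans _ _ 1).
    have : (n.+2%:R : R)^-1 <= 1 by rewrite invf_le1 ?ltr0n// ler1n.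
    by rewrite /c; set t := _^-1; lra.
  by rewrite -ler_pdivrMl ?ltr0n// mulr1; apply: ltW; exact: lt_trans Pky.
- move=> x /ex_Phi_gt0 h.
  (* At the least n with a positive bump nothing is subtracted. *)
  have [n n0 nmin] := ex_minnP h.
  exists n; rewrite /psi lt_max; apply/orP; right.
  rewrite big1 ?mulr0 ?subr0// => i _; apply/eqP; rewrite eq_le bump_ge0// andbT leNgt.
  by apply/negP => /nmin; rewrite leqNgt ltn_ord.
- move=> n x /selP[e [[nKe Ee] xe ->]]; split; first by case: (firstP nKe).
  by apply: Ee; rewrite distrC; have := c_gt0 n; lra.
(* If [psi n] is positive at some y near x, the index selected at y serves every z near x: the
   points of [E n] behind y and z are less than 3 * c n apart. Otherwise the claim is vacuous near
   x. *)
- move=> n x; have [[y [yx y0]]|nh] := pselect (exists y, `|x - y| < c n / 2 /\ 0 < psi n y).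
    exists (sel n y); near=> z => z0.
    have xz : `|x - z| < c n / 2.
      near: z; apply: (@cvgr_dist_lt _ X _ _ _ id) => //; by rewrite divr_gt0.
    have [e [Ee ye ->]] := selP y0; have [e' [Ee' ze ->]] := selP z0.
    apply: E_first Ee' Ee _.
    have := ler_distD z e' e; have := ler_distD x z e; have := ler_distD y x e.
    rewrite (distrC z x) (distrC e' z); have := c_gt0 n; lra.
  exists x; near=> z => z0; exfalso; apply: nh; exists z; split=> //.
  near: z; apply: (@cvgr_dist_lt _ X _ _ _ id) => //; by rewrite divr_gt0.
Unshelve. all: by end_near. Qed.

End partition.

(** * Barycentric extension of a continuous map *)

Section extension.
Context (R : realType) (X Y : normedModType R).

Definition barycenter N (w : nat -> R) (v : nat -> Y) : Y :=
  (\sum_(n < N) w n)^-1 *: \sum_(n < N) w n *: v n.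

(** Closed balls are convex. This gives both continuity at points of [K] and the bound on the
    extension. *)
Lemma barycenter_ball N w v c e : (forall n, 0 <= w n) ->
  (exists2 n, (n < N)%N & 0 < w n) ->
  (forall n, 0 < w n -> `|v n - c| <= e) -> `|barycenter N w v - c| <= e.
Proof.
move=> w0 [n nN wn0] ve.
have W0 : 0 < \sum_(n < N) w n.
  by rewrite (bigD1 (Ordinal nN))//= ltr_pwDl// sumr_ge0.
have -> : barycenter N w v - c =
    (\sum_(n < N) w n)^-1 *: \sum_(n < N) w n *: (v n - c).
  under [X in _ *: X]eq_bigr do rewrite scalerBr.
  by rewrite sumrB -scaler_suml scalerBr scalerA mulVf ?gt_eqF// scale1r.
rewrite normrZ gtr0_norm ?invr_gt0// ler_pdivrMl// mulr_suml.
apply: le_trans (ler_norm_sum _ _ _) _; apply: ler_sum => i _.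
rewrite normrZ ger0_norm//.
have := w0 i; rewrite le_eqVlt => /predU1P[<-|wi]; first by rewrite !mul0r.
by rewrite ler_pM2l// ve.
Qed.

(** Allows the truncation rank of a point x to replace the varying ranks of its neighbours. *)
Lemma barycenter_trunc N N' w v : (forall n, (N <= n)%N -> w n = 0) ->
  (forall n, (N' <= n)%N -> w n = 0) -> barycenter N w v = barycenter N' w v.
Proof.
wlog NN' : N N' / (N <= N')%N => [hw h h'|h _].
  by have /orP[] := leq_total N N' => ?; [|symmetry]; exact: hw.
rewrite /barycenter -!(big_mkord xpredT w) -!(big_mkord xpredT (fun n => w n *: v n)).
rewrite !(big_cat_nat (leq0n N) NN') /=.
have tail0 (V : zmodType) (g : nat -> V) : (forall n, (N <= n)%N -> g n = 0) ->
    \sum_(N <= n < N') g n = 0.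
  by move=> g0; rewrite big_nat big1// => n /andP[/g0].
by rewrite !tail0 ?addr0// => n /h ->; rewrite scale0r.
Qed.

Lemma dugundji (K : set X) (f : X -> Y) : closed K -> {within K, continuous f} ->
  exists F : X -> Y, [/\ continuous F, forall a, K a -> F a = f a &
    forall M, 0 <= M -> (forall a, K a -> `|f a| <= M) -> forall x, `|F x| <= M].
Proof.
move=> K_closed /subspace_continuousP fc.
have [K_neq0|/set0P/negP/negPn/eqP K0] := pselect (K !=set0); last first.
  exists (cst 0); split=> [x|a|M M0 _ x]; [exact: cst_continuous|by rewrite K0|].
  by rewrite /cst normr0.
have [psi [s [[psi0 cpsi] lf ppos sK sloc]]] := ex_partition K_closed K_neq0.
have lf' x : exists N, ~ K x -> \forall y \near x, forall n, (N <= n)%N -> psi n y = 0.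
  by have [Kx|/lf[N]] := pselect (K x); [exists 0|exists N].
pose rk x := sval (cid (lf' x)).
have rkP x : ~ K x -> \forall y \near x, forall n, (rk x <= n)%N -> psi n y = 0.
  by move=> nKx; exact: (svalP (cid (lf' x))).
have rk0 x : ~ K x -> forall n, (rk x <= n)%N -> psi n x = 0.
  by move=> /rkP/nbhs_singleton.
pose F x := if pselect (K x) then f x else
  barycenter (rk x) (psi^~ x) (fun n => f (s n x)).
have FK a : K a -> F a = f a by rewrite /F; case: pselect.
have FnK x : ~ K x -> F x = barycenter (rk x) (psi^~ x) (fun n => f (s n x)).
  by rewrite /F; case: pselect.
have Fball x c e : ~ K x ->
    (forall n, 0 < psi n x -> `|f (s n x) - c| <= e) -> `|F x - c| <= e.
  move=> nKx h; rewrite FnK//; apply: barycenter_ball => //.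
  have [n n0] := ppos _ nKx; exists n => //.
  by rewrite ltnNge; apply/negP => /(rk0 _ nKx) E; rewrite E ltxx in n0.
exists F; split=> //.
- move=> x; have [Kx|nKx] := pselect (K x).
    apply/cvgrPdist_le => e e0.
    have /cvgrPdist_le/(_ _ e0) := fc x Kx.
    rewrite !near_withinE -nbhs_ballE => -[d /= d0 hd].
    have hd' a : K a -> `|x - a| < d -> `|f x - f a| <= e.
      by move=> Ka xa; apply: hd => //; rewrite -ball_normE.
    near=> y; rewrite FK//.
    (* As s n y is almost nearest to y, |x - s n y| <= |x - y| + 3|x - y| < d. *)
    have xy : `|x - y| < d / 4.
      by near: y; apply: (@cvgr_dist_lt _ X _ _ _ id) => //; rewrite divr_gt0.
    have [Ky|nKy] := pselect (K y); first by rewrite FK//; apply: hd' => //; lra.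
    rewrite distrC; apply: Fball => // n /sK[Ks /(_ x Kx) ys].
    rewrite distrC; apply: hd' => //; have := ler_distD y x (s n y).
    by rewrite (distrC y x) in ys; lra.
  have [a aP] := choice (fun n => sloc n x).
  have nK : \forall y \near x, ~ K y.
    by apply: open_nbhs_nbhs; split=> //; exact: closed_openC.
  have al : \forall y \near x, forall n : 'I_(rk x), 0 < psi n y -> s n y = a n.
    by apply: filter_forall => n; exact: aP.
  (* With the indices frozen at [a n] and the rank at that of x, F is near x a finite combination of
     constant vectors with continuous coefficients. *)
  have eqF : {near x, (fun y => barycenter (rk x) (psi^~ y) (f \o a)) =1 F}.
    near=> y.
    have nKy : ~ K y by near: y.
    rewrite FnK// (@barycenter_trunc (rk y) (rk x)); last 2 first.
      exact: rk0.
      by near: y; exact: rkP.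
    congr (_ *: _); apply: eq_bigr => n _.
    have := psi0 n y; rewrite le_eqVlt => /predU1P[<-|n0]; first by rewrite !scale0r.
    by congr (_ *: f _); symmetry; move: n n0; near: y.
  rewrite /continuous_at -(nbhs_singleton eqF).
  apply: cvg_trans (near_eq_cvg eqF) _.
  have W0 : 0 < \sum_(n < rk x) psi n x.
    have [n n0] := ppos _ nKx.
    have nN : (n < rk x)%N.
      by rewrite ltnNge; apply/negP => /(rk0 _ nKx) E; rewrite E ltxx in n0.
    by rewrite (bigD1 (Ordinal nN))//= ltr_pwDl// sumr_ge0.
  apply: cvgZ.
    apply: cvgV; first by rewrite gt_eqF.
    by apply: cvg_big => [|n _]; [exact: add_continuous|exact: cpsi].
  apply: cvg_big => [|n _]; first exact: add_continuous.
  by apply: cvgZr_tmp; exact: cpsi.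
- move=> M M0 fM x; have [Kx|nKx] := pselect (K x); first by rewrite FK// fM.
  rewrite -[F x]subr0; apply: Fball => // n /sK[Ks _].
  by rewrite subr0 fM.
Unshelve. all: by end_near. Qed.

End extension.

(** * Integrals and almost everywhere statements *)

Section ae_integral.
Context d (T : measurableType d) (R : realType) (mu : {measure set T -> \bar R}).
Implicit Types f g : T -> R.

Lemma ae_le_integrable f g : measurable_fun setT f ->
  (\forall y \ae mu, `|f y| <= g y) ->
  mu.-integrable setT (EFin \o g) -> mu.-integrable setT (EFin \o f).
Proof.
move=> mf fg /integrableP[mg ig]; apply/integrableP; split.
  exact/measurable_EFinP.
apply: le_lt_trans ig; apply: ae_ge0_le_integral => //.
- by apply: measurableT_comp => //; exact/measurable_EFinP.
- exact: measurableT_comp.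
- by apply: filterS fg => y fgy _ /=; rewrite lee_fin (le_trans fgy)// ler_norm.
Qed.

Lemma ae_eq_Rintegral f g : measurable_fun setT f -> measurable_fun setT g ->
  (\forall y \ae mu, f y = g y) -> \int[mu]_y f y = \int[mu]_y g y.
Proof.
move=> mf mg fg; rewrite /Rintegral; congr fine.
apply: ae_eq_integral => //; [exact/measurable_EFinP|exact/measurable_EFinP|].
by apply: filterS fg => y fgy _; rewrite fgy.
Qed.

(** The minimum of f and g equals f almost everywhere and lies below g everywhere, which reduces the
    claim to pointwise comparison. *)
Lemma ae_le_Rintegral f g : mu.-integrable setT (EFin \o f) ->
  mu.-integrable setT (EFin \o g) ->
  (\forall y \ae mu, f y <= g y) -> \int[mu]_y f y <= \int[mu]_y g y.
Proof.
move=> If Ig fg.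
have mf : measurable_fun setT f by apply/measurable_EFinP; exact: measurable_int If.
have mg : measurable_fun setT g by apply/measurable_EFinP; exact: measurable_int Ig.
have mm : measurable_fun setT (fun y => Num.min (f y) (g y)).
  exact: measurable_minr.
have E : \forall y \ae mu, f y = Num.min (f y) (g y).
  by apply: filterS fg => y fgy; rewrite min_l.
rewrite (ae_eq_Rintegral mf mm E); apply: le_Rintegral => //.
  apply: (@ae_le_integrable _ (fun y => `|f y|)) => //; last exact: integrable_norm.
  by apply: filterS E => y <-.
by move=> y _; rewrite ge_min lexx orbT.
Qed.

Lemma ae_eq0_Rintegral f : mu.-integrable setT (EFin \o f) -> (forall y, 0 <= f y) ->
  \int[mu]_y f y = 0 -> \forall y \ae mu, f y = 0.
Proof.
move=> If f0 i0.
have mf := measurable_int mu If.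
have i1 : (\int[mu]_y `|(EFin \o f) y| = 0)%E.
  under eq_integral do rewrite /= ger0_norm//.
  by rewrite -[LHS]fineK ?integrable_fin_num//; congr EFin.
move: i1 => /(ae_eq_integral_abs mu measurableT mf); apply: filterS => y /(_ I).
by move=> [].
Qed.

(** The integrals are dominated by a geometric series, so the sum of the f k is integrable, hence
    finite almost everywhere, and its terms tend to 0. *)
Lemma ae_cvg0_Rintegral (f : nat -> T -> R) :
  (forall k, mu.-integrable setT (EFin \o f k)) -> (forall k y, 0 <= f k y) ->
  (forall k, \int[mu]_y f k y <= 2^-1 ^+ k) ->
  \forall y \ae mu, f ^~ y @ \oo --> 0.
Proof.
move=> If f0 lef.
have mf k : measurable_fun setT (EFin \o f k) := measurable_int mu (If k).
have fin : mu.-integrable setT (fun y => \sum_(k <oo) (f k y)%:E)%E.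
  apply/integrableP; split.
    apply: (@ge0_emeasurable_sum _ _ _ setT (fun k => EFin \o f k) predT) => //.
    by move=> k y _ _; rewrite lee_fin.
  have sum_ge0 y : (0 <= \sum_(k <oo) (f k y)%:E)%E.
    by apply: nneseries_ge0 => k _ _; rewrite lee_fin.
  under eq_integral do rewrite gee0_abs//.
  rewrite (@integral_nneseries _ _ _ mu setT measurableT (fun k => EFin \o f k))//; last first.
    by move=> k y _; rewrite lee_fin.
  apply: (@le_lt_trans _ _ (\sum_(k <oo) (2^-1 ^+ k)%:E)%E).
    apply: lee_nneseries => [k _ _|k _].
      by apply: integral_ge0 => y _; rewrite lee_fin.
    by have := lef k; rewrite -lee_fin fineK//; exact: (integrable_fin_num measurableT (If k)).
  apply: (@le_lt_trans _ _ (1 * (1 - 2^-1)^-1)%:E); last exact: ltry.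
  apply: lime_le; first by apply: is_cvg_nneseries => k _ _; rewrite lee_fin.
  apply: nearW => n; rewrite sumEFin lee_fin.
  have := @geometric_le_lim R n 1 2^-1 ler01.
  rewrite gtr0_norm ?invf_lt1 ?ltr1n// => /(_ _ _)/(le_trans _); apply => //.
  by rewrite /series/= le_eqVlt; apply/orP; left; apply/eqP/eq_bigr => i _; rewrite mul1r.
have := integrable_ae measurableT fin; apply: filterS => y /(_ I) fy.
apply: cvg_series_cvg_0; apply: nnseries_is_cvg => //.
by move: fy; rewrite ge0_fin_numE//; apply: nneseries_ge0 => k _ _; rewrite lee_fin.
Qed.

Lemma Rintegral_sum I (r : seq I) (f : I -> T -> R) :
  (forall i, mu.-integrable setT (EFin \o f i)) ->
  \int[mu]_y (\sum_(i <- r) f i y) = \sum_(i <- r) \int[mu]_y f i y.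
Proof.
move=> If; elim: r => [|i r ih].
  by under eq_Rintegral do rewrite big_nil; rewrite big_nil /Rintegral integral0.
under eq_Rintegral do rewrite big_cons.
rewrite big_cons RintegralD// ?ih//.
rewrite (_ : EFin \o _ = (fun y => \sum_(j <- r) (f j y)%:E)%E).
  by apply: integrable_sum => // j _; exact: If.
by apply/funext => y; rewrite /= sumEFin.
Qed.

Lemma dominated_cvg0_Rintegral (f : nat -> T -> R) g :
  (forall k, measurable_fun setT (f k)) -> mu.-integrable setT (EFin \o g) ->
  (\forall y \ae mu, f ^~ y @ \oo --> 0) ->
  (forall k, \forall y \ae mu, `|f k y| <= g y) ->
  (fun k => \int[mu]_y f k y) @ \oo --> 0.
Proof.
move=> mf Ig f0 fg.
have f0' : {ae mu, forall y, setT y -> (EFin \o f k) y @[k --> \oo] --> (cst 0%E : T -> \bar R) y}.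
  by apply: filterS f0 => y yf _; apply: cvg_EFin; [exact: nearW|].
have fg' : {ae mu, forall y k, setT y -> (`|(EFin \o f k) y| <= (EFin \o g) y)%E}.
  have := ae_foralln fg; apply: filterS => y h k _; exact: h.
have mf' k : measurable_fun setT (EFin \o f k) by exact/measurable_EFinP.
have [_ _] := dominated_convergence measurableT mf' (measurable_cst _) f0' Ig fg'.
by rewrite integral0 => /fine_cvg.
Qed.

End ae_integral.

Section Lfun2.
Context d (T : measurableType d) (R : realType) (mu : {finite_measure set T -> \bar R}).
Implicit Types f g : T -> R.

Lemma Lfun2P f : f \in Lfun mu 2%:E <->
  measurable_fun setT f /\ mu.-integrable setT (EFin \o (fun y => f y ^+ 2)).
Proof.
split=> [f2|[mf If]].
  split; last exact: Lfun2_integrable_sqr.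
  by move: f2 => /andP[]; rewrite inE.
apply/andP; split; rewrite inE//= /finite_norm unlock.
apply: poweR_lty; move/integrableP: If => [_]; apply: le_lt_trans.
apply: ge0_le_integral => //.
- by move=> y _; exact: poweR_ge0.
- apply/measurable_EFinP/(@measurableT_comp _ _ _ _ _ _ (@powR R ^~ 2)) => //.
  exact: measurableT_comp.
- by apply: measurableT_comp => //; apply/measurable_EFinP; exact: measurable_funX.
- by move=> y _; rewrite /= lee_fin powR_mulrn// normrX.
Qed.

Lemma Lfun2_sum I (r : seq I) (f : I -> T -> R) : (forall i, f i \in Lfun mu 2%:E) ->
  (fun y => \sum_(i <- r) f i y) \in Lfun mu 2%:E.
Proof.
move=> fL; have [h0 hD] := Lfun_submod_closed mu (lee1n 2 : (1 <= 2%:E :> \bar R)%E).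
elim: r => [|i r ih].
  by rewrite (_ : (fun _ => _) = 0)//; apply/funext => y; rewrite big_nil.
rewrite (_ : (fun _ => _) = 1 *: f i + (fun y => \sum_(i <- r) f i y)); first exact: hD.
by apply/funext => y; rewrite big_cons scale1r.
Qed.

Lemma Lfun2_ae_bound f g (C : R) : measurable_fun setT f -> g \in Lfun mu 2%:E ->
  (\forall y \ae mu, `|f y| <= C) -> (fun y => f y * g y) \in Lfun mu 2%:E.
Proof.
move=> mf /Lfun2P[mg Ig] fC; apply/Lfun2P; split; first exact: measurable_funM.
apply: (@ae_le_integrable _ _ _ _ _ (fun y => C ^+ 2 * g y ^+ 2)).
- by apply: measurable_funX; exact: measurable_funM.
- apply: filterS fC => y fyC; rewrite ger0_norm ?sqr_ge0// exprMn.
  rewrite ler_wpM2r ?sqr_ge0// -[leLHS]real_normK ?num_real// ler_sqr// nnegrE//.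
  exact: le_trans fyC.
- exact: (integrableZl measurableT (C ^+ 2) Ig).
Qed.

End Lfun2.

(** * Elliptic matrices *)

Section matrices.
Context (R : realType).

Definition frob m n (M : 'M[R]_(m, n)) := frobenius_prod M M.

Lemma frob_ge0 m n (M : 'M[R]_(m, n)) : 0 <= frob M.
Proof.
by apply: sumr_ge0 => i _; apply: sumr_ge0 => j _; rewrite -expr2 sqr_ge0.
Qed.

Lemma frob_entry m n (M : 'M[R]_(m, n)) i j : M i j ^+ 2 <= frob M.
Proof.
have s0 i' j' : 0 <= M i' j' * M i' j' by rewrite -expr2 sqr_ge0.
rewrite /frob /frobenius_prod (bigD1 i)//= (bigD1 j)//= expr2 -addrA lerDl.
by rewrite addr_ge0// ?sumr_ge0// => k _; rewrite sumr_ge0.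
Qed.

Lemma frob_le m n (M : 'M[R]_(m, n)) c : (forall i j, `|M i j| <= c) ->
  frob M <= c ^+ 2 *+ n *+ m.
Proof.
move=> Mc; rewrite -[X in _ *+ X]card_ord -sumr_const; apply: ler_sum => i _.
rewrite -[X in _ *+ X]card_ord -sumr_const; apply: ler_sum => j _.
rewrite -expr2 -[leLHS]real_normK ?num_real// ler_sqr ?nnegrE//.
exact: le_trans (Mc i j).
Qed.

Context (d : nat).
Implicit Types (x y z : 'cV[R]_d) (M : 'M[R]_d).

Lemma dotpE x y : dotp x y = \sum_i x i 0 * y i 0.
Proof. by rewrite /dotp mxE; apply: eq_bigr => i _; rewrite mxE. Qed.

Lemma dotpC x y : dotp x y = dotp y x.
Proof. by rewrite !dotpE; apply: eq_bigr => i _; rewrite mulrC. Qed.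

Lemma dotpDl x y z : dotp (x + y) z = dotp x z + dotp y z.
Proof. by rewrite /dotp linearD/= mulmxDl mxE. Qed.

Lemma dotpZl a x z : dotp (a *: x) z = a * dotp x z.
Proof. by rewrite /dotp linearZ/= -scalemxAl mxE. Qed.

Lemma dotp_ge0 x : 0 <= dotp x x.
Proof. by rewrite dotpE sumr_ge0// => i _; rewrite -expr2 sqr_ge0. Qed.

Definition dotp_inner : semi_inner 'cV[R]_d := SemiInner dotpC dotpDl dotpZl dotp_ge0.

Lemma dotpDr x y z : dotp z (x + y) = dotp z x + dotp z y.
Proof. exact: (sipDr dotp_inner). Qed.

Lemma dotpZr a x z : dotp z (a *: x) = a * dotp z x.
Proof. exact: (sipZr dotp_inner). Qed.

Lemma dotpNl x z : dotp (- x) z = - dotp x z.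
Proof. by rewrite -scaleN1r dotpZl mulN1r. Qed.

Lemma dotpNr x z : dotp z (- x) = - dotp z x.
Proof. by rewrite -scaleN1r dotpZr mulN1r. Qed.

Lemma dotp_delta M i j :
  dotp (delta_mx i 0 : 'cV[R]_d) (M *m (delta_mx j 0 : 'cV[R]_d)) = M i j.
Proof. by rewrite /dotp trmx_delta mulmxA -rowE -colE !mxE. Qed.

Lemma dotp_deltaxx i : dotp (delta_mx i 0 : 'cV[R]_d) (delta_mx i 0) = 1.
Proof. by have := dotp_delta 1%:M i i; rewrite mul1mx mxE eqxx. Qed.

Lemma frob_rows n (M : 'M[R]_(n, d)) : frob M = \sum_l dotp (row l M)^T (row l M)^T.
Proof. by apply: eq_bigr => i _; rewrite dotpE; apply: eq_bigr => j _; rewrite !mxE. Qed.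

(** Cauchy-Schwarz on each row: the Frobenius norm dominates the operator norm. *)
Lemma dotp_mulmx_le M x : dotp (M *m x) (M *m x) <= frob M * dotp x x.
Proof.
rewrite frob_rows dotpE mulr_suml; apply: ler_sum => i _.
have -> : (M *m x) i 0 = dotp (row i M)^T x by rewrite /dotp trmxK -row_mul [RHS]mxE.
by rewrite -expr2; exact: (sip_CS dotp_inner).
Qed.

Lemma quad_le M x e : 0 <= e -> frob M <= e ^+ 2 -> `|dotp x (M *m x)| <= e * dotp x x.
Proof.
move=> e0 Me; have d0 := dotp_ge0 x.
rewrite -ler_sqr ?nnegrE ?mulr_ge0// real_normK ?num_real//.
apply: le_trans (sip_CS dotp_inner _ _) _ => /=.
have -> : (e * dotp x x) ^+ 2 = dotp x x * (e ^+ 2 * dotp x x) by ring.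
rewrite ler_wpM2l//; apply: le_trans (dotp_mulmx_le _ _) _.
by rewrite ler_wpM2r.
Qed.

(** Expansion of |a y + x|^2 >= 0, divided by 2a. *)
Lemma dotp_young a x y : 0 < a ->
  - dotp x y <= a / 2 * dotp y y + (2 * a)^-1 * dotp x x.
Proof.
move=> a0; have := dotp_ge0 (a *: y + x).
rewrite dotpDl !dotpDr !dotpZl !dotpZr (dotpC y x) => h.
have -> : a / 2 * dotp y y + (2 * a)^-1 * dotp x x = (2 * a)^-1 *
  (a * (a * dotp y y) + dotp x x) by field; rewrite gt_eqF.
rewrite ler_pdivlMl ?mulr_gt0//; lra.
Qed.

Definition elliptic alpha beta M := M^T = M /\ forall xi : 'cV[R]_d,
  alpha * dotp xi xi <= dotp xi (M *m xi) <= beta * dotp xi xi.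

(** Polarisation: 4 M_ij is the difference of the quadratic form at e_i + e_j and at e_i - e_j. *)
Lemma elliptic_entry alpha beta M i j : 0 <= alpha -> elliptic alpha beta M ->
  `|M i j| <= beta.
Proof.
move=> a0 [sM hM].
pose u : 'cV[R]_d := delta_mx i 0; pose v : 'cV[R]_d := delta_mx j 0.
have uu : dotp u u = 1 := dotp_deltaxx i.
have vv : dotp v v = 1 := dotp_deltaxx j.
have vu : dotp v (M *m u) = M i j by rewrite dotp_delta -[in LHS]sM mxE.
have uv : dotp u (M *m v) = M i j by rewrite dotp_delta.
have := hM (u + v); have := hM (u - v).
have := dotp_ge0 (u + v); have := dotp_ge0 (u - v).
rewrite !(mulmxDr, mulmxN, dotpDl, dotpDr, dotpNl, dotpNr) uu vv uv vu (dotpC v u).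
set s := dotp u v => p1 p2 /andP[h1 h2] /andP[h3 h4].
have b0 : 0 <= beta.
  by have /andP[] := hM u; rewrite uu !mulr1 => /(le_trans a0)/le_trans h /h.
have s1 : 0 <= 1 - s by lra.
have s2 : 0 <= 1 + s by lra.
have := mulr_ge0 a0 s1; have := mulr_ge0 a0 s2.
have := mulr_ge0 b0 s1; have := mulr_ge0 b0 s2.
rewrite ler_norml => *; apply/andP; split; lra.
Qed.

Lemma elliptic_closed alpha beta M :
  (forall e, 0 < e -> exists2 N, elliptic alpha beta N & frob (N - M) <= e ^+ 2) ->
  elliptic alpha beta M.
Proof.
move=> hN; split=> [|x].
  apply/matrixP => i j; rewrite mxE; apply/eqP; rewrite -subr_eq0 -normr_eq0.
  rewrite eq_le normr_ge0 andbT; apply/ler_addgt0Pr => e e0; rewrite add0r.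
  have [|N [sN _] Ne] := hN (e / 2); first by rewrite divr_gt0.
  have he k l : `|N k l - M k l| <= e / 2.
    have e2 : 0 <= e / 2 by rewrite divr_ge0// ltW.
    rewrite -ler_sqr ?nnegrE// real_normK ?num_real//.
    by apply: le_trans Ne; have := frob_entry (N - M) k l; rewrite !mxE.
  have := he i j; have := he j i; have -> : N j i = N i j by rewrite -[in LHS]sN mxE.
  rewrite -[M j i - M i j](subrKA (N i j)) => h1 h2.
  rewrite (le_trans (ler_normD _ _))// (distrC (M j i)) [leRHS]splitr; exact: lerD.
have d0 := dotp_ge0 x.
have H e : 0 < e -> alpha * dotp x x <= dotp x (M *m x) + e /\
    dotp x (M *m x) <= beta * dotp x x + e.
  move=> e0; have D0 : 0 < dotp x x + 1 by lra.
  (* The denominator |x|^2 + 1 turns the Frobenius error into an error of at most e in the quadratic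
     form at x. *)
  have [|N [_ /(_ x)/andP[N1 N2] Ne]] := hN (e / (dotp x x + 1)); first by rewrite divr_gt0.
  have := quad_le x (ltW (divr_gt0 e0 D0)) Ne; rewrite mulmxBl dotpDr dotpNr.
  have : e / (dotp x x + 1) * dotp x x <= e.
    by rewrite mulrAC ler_pdivrMr// ler_wpM2l ?ltW//; lra.
  rewrite ler_norml => h /andP[h1 h2]; lra.
by apply/andP; split; apply/ler_addgt0Pr => e /H[].
Qed.

End matrices.

(** * Square integrable fields *)

(** The rate is summable, so that in L^2 the whole sequence converges almost everywhere and no
    subsequence has to be extracted. *)
Lemma closure_seq (R : realType) (V : normedModType R) (K : set V) x : closure K x ->
  exists u : nat -> V, forall k, K (u k) /\ `|u k - x| ^+ 2 <= 2^-1 ^+ k.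
Proof.
move=> Kx.
suff h : forall k, exists a, K a /\ `|a - x| ^+ 2 <= 2^-1 ^+ k by have [u] := choice h; exists u.
move=> k.
have e0 : 0 < (2^-1 : R) ^+ k by rewrite exprn_gt0// invr_gt0.
have s0 : 0 < Num.sqrt ((2^-1 : R) ^+ k) by rewrite sqrtr_gt0.
have [a [Ka]] := Kx _ (nbhsx_ballx x _ s0).
rewrite -ball_normE /= distrC => ax; exists a; split=> //.
by rewrite -[leRHS](sqr_sqrtr (ltW e0)) ler_sqr ?nnegrE ?sqrtr_ge0//; exact: ltW.
Qed.

Lemma seminorm_sqr (R : realType) (V : lmodType R) (b : semi_inner V) x :
  seminorm b x ^+ 2 = b x x.
Proof. by rewrite sqr_sqrtr// sip_ge0. Qed.

Lemma hquot_dist (R : realType) (V : lmodType R) (b : semi_inner V) (x y : hquot b) :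
  `|x - y| = seminorm b (repr x - repr y).
Proof.
rewrite -[in LHS](reprK x) -[in LHS](reprK y) -hquot_normE hquot_piD.
by rewrite -(scaleN1r (repr y)) hquot_piZ scaleN1r.
Qed.

Section fields.
Context (R : realType) (d : nat).
Notation T := (d.-tuple (measurableTypeR R)).
Notation mu := (torus_measure R d).

Definition measurable_field m n (X : T -> 'M[R]_(m, n)) :=
  forall i j, measurable_fun setT (fun y => X y i j).

Definition L2_mx m n (X : T -> 'M[R]_(m, n)) :=
  forall i j, (fun y => X y i j) \in Lfun mu 2%:E.

Lemma L2_mx_measurable m n (X : T -> 'M[R]_(m, n)) : L2_mx X -> measurable_field X.
Proof. by move=> hX i j; have /Lfun2P[] := hX i j. Qed.

Lemma L2field_mx m n (X : L2field R d m n) : L2_mx X.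
Proof. by move=> i j; exact: L2_entry. Qed.

Lemma L2_mxP m n (X : T -> 'M[R]_(m, n)) : L2_mx X <-> X \in @L2_pred R d m n.
Proof. by split=> [h|/L2_predP//]; apply/L2_predP. Qed.

Lemma L2_mxD m n (X Y : T -> 'M[R]_(m, n)) : L2_mx X -> L2_mx Y -> L2_mx (X \+ Y).
Proof. by move=> /L2_mxP hX /L2_mxP hY; apply/L2_mxP; exact: rpredD. Qed.

Lemma L2_mxN m n (X : T -> 'M[R]_(m, n)) : L2_mx X -> L2_mx (fun y => - X y).
Proof.
move=> /L2_mxP hX; apply/L2_mxP.
rewrite (_ : (fun _ => _) = -1 *: X); first exact: rpredZ.
by apply/funext => y /=; rewrite -scaleN1r.
Qed.

Lemma L2_mx_cst m n (M : 'M[R]_(m, n)) : L2_mx (fun=> M).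
Proof. by move=> i j; exact: Lfun_cst. Qed.

Lemma L2_mx_row m n (X : T -> 'M[R]_(m, n)) l : L2_mx X ->
  L2_mx (fun y => (row l (X y))^T).
Proof.
move=> hX i j; rewrite (_ : (fun _ => _) = (fun y => X y l i)); first exact: hX.
by apply/funext => y; rewrite !mxE.
Qed.

Lemma L2_mx_mulmx m n p (A : T -> 'M[R]_(m, n)) (X : T -> 'M[R]_(n, p)) C :
  measurable_field A -> (forall i j, \forall y \ae mu, `|A y i j| <= C) ->
  L2_mx X -> L2_mx (fun y => A y *m X y).
Proof.
move=> mA AC hX i j.
rewrite (_ : (fun _ => _) = (fun y => \sum_(k <- enum 'I_n) (A y i k * X y k j))); last first.
  by apply/funext => y; rewrite mxE big_enum.
apply: Lfun2_sum => k; exact: Lfun2_ae_bound (mA i k) (hX k j) (AC i k).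
Qed.

Lemma measurable_dotp (x z : T -> 'cV[R]_d) : measurable_field x -> measurable_field z ->
  measurable_fun setT (fun y => dotp (x y) (z y)).
Proof.
move=> mx mz; rewrite (_ : (fun _ => _) = (fun y => \sum_i x y i 0 * z y i 0)).
  by apply: measurable_sum => i; exact: measurable_funM.
by apply/funext => y; rewrite dotpE.
Qed.

Lemma integrable_dotp (x z : T -> 'cV[R]_d) : L2_mx x -> L2_mx z ->
  mu.-integrable setT (EFin \o (fun y => dotp (x y) (z y))).
Proof.
move=> hx hz; rewrite (_ : EFin \o _ = (fun y => \sum_i (x y i 0 * z y i 0)%:E)%E).
  apply: integrable_sum => // i _; apply/Lfun1_integrable.
  exact: (Lfun2_mul_Lfun1 (hx i 0) (hz i 0)).
by apply/funext => y; rewrite /= dotpE sumEFin.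
Qed.

Lemma integrable_frob m n (X : T -> 'M[R]_(m, n)) : L2_mx X ->
  mu.-integrable setT (EFin \o (fun y => frob (X y))).
Proof.
move=> hX; rewrite (_ : EFin \o _ =
    (fun y => \sum_i \sum_j (X y i j * X y i j)%:E)%E).
  apply: integrable_sum => // i _; apply: integrable_sum => // j _.
  by apply/Lfun1_integrable; exact: (Lfun2_mul_Lfun1 (hX i j) (hX i j)).
apply/funext => y /=; rewrite /frob /frobenius_prod -sumEFin.
by apply: eq_bigr => i _; rewrite sumEFin.
Qed.

Lemma L2_seminorm0 m n (X : L2field R d m n) : seminorm (L2_inner R d m n) X = 0 ->
  \forall y \ae mu, X y = 0.
Proof.
move=> X0.
have : \int[mu]_y frob (X y) = 0 by have := seminorm_sqr (L2_inner R d m n) X; rewrite X0 expr0n.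
move=> /(ae_eq0_Rintegral (integrable_frob (L2field_mx X)) (fun y => frob_ge0 (X y))).
apply: filterS => y Xy; apply/matrixP => i j; rewrite mxE; apply/eqP.
by rewrite -sqrf_eq0 eq_le sqr_ge0 andbT -Xy frob_entry.
Qed.

Lemma L2_dist m n (X Y : L2 R d m n) :
  `|X - Y| ^+ 2 = \int[mu]_y frob (L2repr X y - L2repr Y y).
Proof. by rewrite hquot_dist seminorm_sqr. Qed.

Lemma L2_ae_cvg m n (X : nat -> L2 R d m n) (Y : L2 R d m n) :
  (forall k, `|X k - Y| ^+ 2 <= 2^-1 ^+ k) ->
  \forall y \ae mu, (fun k => frob (L2repr (X k) y - L2repr Y y)) @ \oo --> 0.
Proof.
move=> XY; apply: ae_cvg0_Rintegral => [k|k y|k].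
- by apply: integrable_frob; exact: L2field_mx (repr (X k) - repr Y).
- exact: frob_ge0.
- by rewrite -L2_dist.
Qed.

End fields.

(** * Closedness of the elliptic coefficients in L^2 *)

Section PD.
Context (R : realType) (d : nat).
Notation T := (d.-tuple (measurableTypeR R)).
Notation mu := (torus_measure R d).
Variables alpha beta : R.
Hypothesis alpha_gt0 : 0 < alpha.

Lemma PDP (A : L2 R d d d) :
  PD alpha beta A <-> \forall y \ae mu, elliptic alpha beta (L2repr A y).
Proof.
split=> [[]//|hA]; split=> // i j; rewrite /finite_norm unlock.
case: ifPn => // _; apply: (@le_lt_trans _ _ beta%:E); last exact: ltry.
apply/ess_supP; apply: filterS hA => y Ay /=; rewrite lee_fin.
exact: elliptic_entry (ltW alpha_gt0) Ay.
Qed.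

Lemma PD_entry (A : L2 R d d d) i j : PD alpha beta A ->
  \forall y \ae mu, `|L2repr A y i j| <= beta.
Proof.
by move=> /PDP; apply: filterS => y /(elliptic_entry i j (ltW alpha_gt0)).
Qed.

(** A closure point is the almost everywhere limit of a sequence in [PD], and ellipticity passes to
    pointwise limits. *)
Lemma PD_closed : closed (PD alpha beta : set (L2 R d d d)).
Proof.
move=> A /closure_seq[u uP].
have uA : \forall y \ae mu, (fun k => frob (L2repr (u k) y - L2repr A y)) @ \oo --> 0.
  by apply: L2_ae_cvg => k; case: (uP k).
have uE : \forall y \ae mu, forall k, elliptic alpha beta (L2repr (u k) y).
  by apply: ae_foralln => k; apply/PDP; case: (uP k).
apply/PDP; apply: filterS2 uA uE => y ycvg yell.
apply: elliptic_closed => e e0.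
have e20 : 0 < e ^+ 2 by rewrite exprn_gt0.
have [k _ hk] : \forall k \near \oo, `|frob (L2repr (u k) y - L2repr A y)| <= e ^+ 2.
  exact: cvgr0_norm_le.
exists (L2repr (u k) y) => //; apply: le_trans (ler_norm _) _.
exact: hk (leqnn k).
Qed.

End PD.

(** * The cell problem *)

Section H1_row.
Local Open Scope quotient_scope.
Context (R : realType) (d k : nat).
Notation T := (d.-tuple (measurableTypeR R)).
Notation mu := (torus_measure R d).

Lemma L2_row_subproof n (X : L2field R d k n) l :
  (fun y => row l (X y)) \in @L2_pred R d 1 n.
Proof.
apply/L2_mxP => i j; rewrite (_ : (fun _ => _) = (fun y => X y l j)).
  exact: L2_entry.
by apply/funext => y; rewrite mxE.
Qed.

Definition L2_row n (X : L2field R d k n) l : L2field R d 1 n :=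
  Build_L2field (L2_row_subproof X l).

Lemma H1_row_subproof (u : H1field R d k) l :
  (L2_row (H1pair u).1 l, L2_row (H1pair u).2 l) \in @H1_pred R d 1.
Proof.
have /asboolP[u0 ug] := H1pairP u.
apply/asboolP; split=> [i|phi sphi per i j] /=.
  by under eq_Rintegral do rewrite mxE; exact: u0.
under eq_Rintegral do rewrite mxE.
by under [in RHS]eq_Rintegral do rewrite mxE; exact: ug.
Qed.

(** The cell problem has scalar test functions, so vector-valued functions enter it one component at
    a time. *)
Definition H1_row (u : H1field R d k) l : H1field R d 1 :=
  Build_H1field (H1_row_subproof u l).

Lemma H1_gradB (u v : H1field R d k) y :
  (H1pair (u - v)).2 y = (H1pair u).2 y - (H1pair v).2 y.
Proof. by []. Qed.

Lemma H1_seminorm (u : H1field R d k) :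
  seminorm (H1_inner R d k) u = seminorm (L2_inner R d k d) (H1pair u).2.
Proof. by []. Qed.

(** [hgrad] reads a chosen representative, which determines the gradient of a class only up to a
    null set. *)
Lemma hgrad_pi (u : H1field R d k) :
  \forall y \ae mu, hgrad (\pi_(Hdot1 R d k) u) y = (H1pair u).2 y.
Proof.
have := hquot_reprK (H1_inner R d k) u; rewrite H1_seminorm => /L2_seminorm0.
by apply: filterS => y /eqP uy; apply/eqP; rewrite -subr_eq0 -H1_gradB.
Qed.

Lemma hgrad_mx (u : Hdot1 R d k) : L2_mx (hgrad u).
Proof. exact: L2field_mx (H1pair (repr u)).2. Qed.

End H1_row.

Section cell.
Local Open Scope quotient_scope.
Context (R : realType) (d : nat).
Notation T := (d.-tuple (measurableTypeR R)).
Notation mu := (torus_measure R d).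
Variables alpha beta : R.
Hypothesis alpha_gt0 : 0 < alpha.
Implicit Types (A B : L2 R d d d) (chi : Hdot1 R d d).

Lemma L2repr_measurable A : measurable_field (L2repr A).
Proof. by apply: L2_mx_measurable; exact: L2field_mx (repr A). Qed.

Lemma PD_mulmx A (x : T -> 'cV[R]_d) : PD alpha beta A -> L2_mx x ->
  L2_mx (fun y => L2repr A y *m x y).
Proof.
move=> PA; apply: (@L2_mx_mulmx _ _ _ _ _ _ _ beta); first exact: L2repr_measurable.
by move=> i j; exact: (PD_entry alpha_gt0 i j PA).
Qed.

Lemma frob_elliptic_dist (M N : 'M[R]_d) : elliptic alpha beta M -> elliptic alpha beta N ->
  frob (M - N) <= (beta + beta) ^+ 2 *+ d *+ d.
Proof.
move=> eM eN; apply: frob_le => i j; rewrite !mxE (le_trans (ler_normB _ _))//.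
by rewrite lerD//; exact: (elliptic_entry _ _ (ltW alpha_gt0)).
Qed.

(** Common core of the stability estimate and of the uniform bound: coercivity from below, Young's
    inequality from above. *)
Lemma energy_estimate A (p w : T -> 'cV[R]_d) : PD alpha beta A -> L2_mx p -> L2_mx w ->
  \int[mu]_y dotp (L2repr A y *m w y) (w y) = - (\int[mu]_y dotp (p y) (w y)) ->
  alpha ^+ 2 * \int[mu]_y dotp (w y) (w y) <= \int[mu]_y dotp (p y) (p y).
Proof.
move=> PA hp hw Aw.
have Iw := integrable_dotp hw hw; have Ip := integrable_dotp hp hp.
have Ipw := integrable_dotp hp hw.
have IAw := integrable_dotp (PD_mulmx PA hw) hw.
have h1 : alpha * \int[mu]_y dotp (w y) (w y) <= \int[mu]_y dotp (L2repr A y *m w y) (w y).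
  rewrite -RintegralZl//; apply: ae_le_Rintegral => //.
    exact: (integrableZl measurableT alpha Iw).
  move/(PDP _ alpha_gt0): PA; apply: filterS => y [_ /(_ (w y))/andP[+ _]].
  by rewrite (dotpC (_ *m _)).
(* The weight alpha in Young's inequality lets half of the coercive term absorb the part in w. *)
have h2 : - (\int[mu]_y dotp (p y) (w y)) <=
    alpha / 2 * \int[mu]_y dotp (w y) (w y) + (2 * alpha)^-1 * \int[mu]_y dotp (p y) (p y).
  have IpwN := integrableZl measurableT (-1) Ipw.
  have Iw' := integrableZl measurableT (alpha / 2) Iw.
  have Ip' := integrableZl measurableT (2 * alpha)^-1 Ip.
  rewrite -mulN1r -(RintegralZl _ measurableT Ipw) -(RintegralZl _ measurableT Iw).
  rewrite -(RintegralZl _ measurableT Ip) -RintegralD//; apply: le_Rintegral => //.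
    exact: (integrableD measurableT Iw' Ip').
  by move=> y _; rewrite mulN1r; exact: dotp_young.
rewrite Aw in h1; have := le_trans h1 h2.
set W := \int[mu]_y dotp (w y) (w y); set P := \int[mu]_y dotp (p y) (p y) => h.
have : (2 * alpha) * (alpha / 2 * W) <= P.
  rewrite -ler_pdivlMl ?mulr_gt0//; lra.
by rewrite expr2; have -> : 2 * alpha * (alpha / 2 * W) = alpha * alpha * W by field.
Qed.

(* e_l + grad chi_l, so that the cell problem reads div (A q_l) = 0 *)
Definition cell_field chi l (y : T) : 'cV[R]_d := (row l (hgrad chi y))^T + delta_mx l 0.

Lemma cell_field_mx chi l : L2_mx (cell_field chi l).
Proof. by apply: L2_mxD; [exact/L2_mx_row/hgrad_mx|exact: L2_mx_cst]. Qed.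

(** The two sides of the weak form, tested with component l of u, merge into one integral; almost
    everywhere equality of gradients replaces the class by u itself. *)
Lemma cell_test A chi (u : H1field R d d) l : PD alpha beta A -> cell_solution A chi ->
  \int[mu]_y dotp (L2repr A y *m cell_field chi l y) (row l ((H1pair u).2 y))^T = 0.
Proof.
move=> PA /(_ l (\pi_(Hdot1 R d 1) (H1_row u l))).
pose z y := (row l ((H1pair u).2 y))^T.
have hz : L2_mx z by exact/L2_mx_row/L2field_mx.
have hv := L2_mx_row 0 (hgrad_mx (\pi_(Hdot1 R d 1) (H1_row u l))).
have E (q : T -> 'cV[R]_d) : L2_mx q ->
  \int[mu]_y dotp (L2repr A y *m q y)
     (row 0 (hgrad (\pi_(Hdot1 R d 1) (H1_row u l)) y))^T =
  \int[mu]_y dotp (L2repr A y *m q y) (z y).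
  move=> hq; have mAq := L2_mx_measurable (PD_mulmx PA hq).
  apply: ae_eq_Rintegral.
  - exact: measurable_dotp mAq (L2_mx_measurable hv).
  - exact: measurable_dotp mAq (L2_mx_measurable hz).
  - apply: filterS (hgrad_pi (H1_row u l)) => y ->.
    by congr (dotp _ _^T); apply/rowP => j; rewrite !mxE.
have hg : L2_mx (fun y => (row l (hgrad chi y))^T) by exact/L2_mx_row/hgrad_mx.
have he : L2_mx (fun _ : T => delta_mx l 0 : 'cV[R]_d) by exact: L2_mx_cst.
rewrite (E _ hg) (E _ he) => /eqP; rewrite -subr_eq0 opprK => /eqP <-.
rewrite -RintegralD//; try exact/integrable_dotp/hz/PD_mulmx.
by apply: eq_Rintegral => y _; rewrite mulmxDr dotpDl.
Qed.

Lemma Hdot1_norm (u : H1field R d d) :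
  seminorm (H1_inner R d d) u ^+ 2 =
  \sum_l \int[mu]_y dotp (row l ((H1pair u).2 y))^T (row l ((H1pair u).2 y))^T.
Proof.
rewrite seminorm_sqr -Rintegral_sum; last first.
  by move=> l; apply: integrable_dotp; exact/L2_mx_row/L2field_mx.
by apply: eq_Rintegral => y _; exact: frob_rows.
Qed.

Lemma cell_fieldB chi chi' l y : cell_field chi' l y - cell_field chi l y =
  (row l ((H1pair (repr chi' - repr chi)).2 y))^T.
Proof.
rewrite /cell_field opprD addrACA subrr addr0.
by rewrite H1_gradB linearB/= linearB.
Qed.

Lemma measurable_frob_dist A B :
  measurable_fun setT (fun y => frob (L2repr B y - L2repr A y)).
Proof.
apply/measurable_EFinP; apply: measurable_int.
exact: integrable_frob (L2field_mx (repr B - repr A)).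
Qed.

(** Ellipticity of both matrices bounds |B - A|^2 almost everywhere, so the product with the
    integrable |q_l|^2 is integrable. *)
Lemma integrable_frob_cell A B chi l : PD alpha beta A -> PD alpha beta B ->
  mu.-integrable setT (EFin \o (fun y => frob (L2repr B y - L2repr A y) *
    dotp (cell_field chi l y) (cell_field chi l y))).
Proof.
move=> PA PB.
have Iq := integrable_dotp (@cell_field_mx chi l) (@cell_field_mx chi l).
apply: (@ae_le_integrable _ _ _ _ _ (fun y => ((beta + beta) ^+ 2 *+ d *+ d) *
    dotp (cell_field chi l y) (cell_field chi l y))).
- apply: measurable_funM; first exact: measurable_frob_dist.
  by apply: measurable_dotp; apply: L2_mx_measurable; exact: cell_field_mx.
- move/(PDP _ alpha_gt0): PA; move/(PDP _ alpha_gt0): PB; apply: filterS2 => y eB eA.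
  by rewrite ger0_norm ?mulr_ge0 ?frob_ge0 ?dotp_ge0// ler_wpM2r ?dotp_ge0// frob_elliptic_dist.
- exact: (integrableZl measurableT _ Iq).
Qed.

(** Energy estimate for B with w = q' - q and p = (B - A) q. The right-hand side contains only the
    cell field of A, which stays fixed while B tends to A. *)
Lemma cell_stability_row A B chi chi' l : PD alpha beta A -> PD alpha beta B ->
  cell_solution A chi -> cell_solution B chi' ->
  alpha ^+ 2 * \int[mu]_y dotp (cell_field chi' l y - cell_field chi l y)
    (cell_field chi' l y - cell_field chi l y) <=
  \int[mu]_y (frob (L2repr B y - L2repr A y) * dotp (cell_field chi l y) (cell_field chi l y)).
Proof.
move=> PA PB sA sB.
pose w y := cell_field chi' l y - cell_field chi l y.
pose p y := L2repr B y *m cell_field chi l y - L2repr A y *m cell_field chi l y.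
have hw : L2_mx w.
  by apply: L2_mxD; [|apply: L2_mxN]; exact: cell_field_mx.
have hBq : L2_mx (fun y => L2repr B y *m cell_field chi' l y).
  by apply: PD_mulmx => //; exact: cell_field_mx.
have hAq : L2_mx (fun y => L2repr A y *m cell_field chi l y).
  by apply: PD_mulmx => //; exact: cell_field_mx.
have hp : L2_mx p.
  by apply: L2_mxD; [|apply: L2_mxN]; apply: PD_mulmx => //; exact: cell_field_mx.
have test D chi0 : PD alpha beta D -> cell_solution D chi0 ->
    \int[mu]_y dotp (L2repr D y *m cell_field chi0 l y) (w y) = 0.
  move=> PD0 sD; rewrite -[RHS](cell_test (repr chi' - repr chi) l PD0 sD).
  by apply: eq_Rintegral => y _; rewrite -cell_fieldB.
(* B w + p = B q' - A q, and both fluxes are orthogonal to the gradient w. *)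
have Bw : \int[mu]_y dotp (L2repr B y *m w y) (w y) = - (\int[mu]_y dotp (p y) (w y)).
  apply/eqP; rewrite -subr_eq0 opprK; apply/eqP.
  rewrite -RintegralD//; last 2 first.
  - exact: integrable_dotp (PD_mulmx PB hw) hw.
  - exact: integrable_dotp hp hw.
  rewrite -[RHS](subrr 0) -[X in _ = X - _](test _ _ PB sB).
  rewrite -[X in _ = _ - X](test _ _ PA sA) -RintegralB//; last 2 first.
  - exact: integrable_dotp hBq hw.
  - exact: integrable_dotp hAq hw.
  apply: eq_Rintegral => y _; rewrite -dotpDl -dotpNl -dotpDl mulmxBr.
  by congr dotp; rewrite /p addrA subrK.
apply: le_trans (energy_estimate PB hp hw Bw) _.
apply: le_Rintegral => //; [exact: integrable_dotp|exact: integrable_frob_cell|].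
by move=> y _; rewrite /p -mulmxBl; exact: dotp_mulmx_le.
Qed.

Lemma cell_stability A B chi chi' : PD alpha beta A -> PD alpha beta B ->
  cell_solution A chi -> cell_solution B chi' ->
  alpha ^+ 2 * `|chi' - chi| ^+ 2 <= \int[mu]_y (frob (L2repr B y - L2repr A y) *
    \sum_l dotp (cell_field chi l y) (cell_field chi l y)).
Proof.
move=> PA PB sA sB.
rewrite hquot_dist Hdot1_norm mulr_sumr.
under [leRHS]eq_Rintegral do rewrite mulr_sumr.
rewrite Rintegral_sum; last by move=> l; exact: integrable_frob_cell.
apply: ler_sum => l _; under eq_Rintegral do rewrite -cell_fieldB.
exact: cell_stability_row.
Qed.

(** Here chi itself is the test function and p = A e_l, with |p|^2 at most beta^2 d^2; the third d
    counts the components. *)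
Lemma cell_bound A chi : PD alpha beta A -> cell_solution A chi ->
  alpha ^+ 2 * `|chi| ^+ 2 <= beta ^+ 2 *+ d *+ d *+ d.
Proof.
move=> PA sA; rewrite -(reprK chi) hquot_normE Hdot1_norm mulr_sumr.
rewrite -[X in _ <= _ *+ X]card_ord -sumr_const; apply: ler_sum => l _.
pose w y := (row l ((H1pair (repr chi)).2 y))^T.
pose p y := L2repr A y *m delta_mx l 0 : 'cV[R]_d.
have hw : L2_mx w by exact/L2_mx_row/L2field_mx.
have hp : L2_mx p by apply: PD_mulmx => //; exact: L2_mx_cst.
have Aw : \int[mu]_y dotp (L2repr A y *m w y) (w y) = - \int[mu]_y dotp (p y) (w y).
  apply/eqP; rewrite -subr_eq0 opprK -RintegralD//; last 2 first.
  - exact/integrable_dotp/hw/PD_mulmx.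
  - exact: integrable_dotp.
  rewrite -(cell_test (repr chi) l PA sA); apply/eqP/eq_Rintegral => y _.
  by rewrite /cell_field mulmxDr dotpDl.
apply: le_trans (energy_estimate PA hp hw Aw) _.
have -> : beta ^+ 2 *+ d *+ d = \int[mu]_y (beta ^+ 2 *+ d *+ d).
  rewrite Rintegral_cst// -[LHS]mulr1; congr (_ * _).
  exact: esym (congr1 fine (probability_setT mu)).
apply: ae_le_Rintegral; first exact: integrable_dotp.
  by apply: finite_measure_integrable_cst.
move/(PDP _ alpha_gt0): PA; apply: filterS => y eA.
rewrite /p (le_trans (dotp_mulmx_le _ _))// dotp_deltaxx mulr1.
by apply: frob_le => i j; exact: (elliptic_entry _ _ (ltW alpha_gt0)).
Qed.

Lemma cell_continuous (K : set (L2 R d d d)) (G : L2 R d d d -> Hdot1 R d d) :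
  K `<=` PD alpha beta -> (forall A, K A -> cell_solution A (G A)) ->
  {within K, continuous G}.
Proof.
move=> KP sG; apply/subspace_continuousP => A KA.
apply/cvgrPdist_lt => e e0; rewrite near_withinE.
(* Either some 2^-k gives a radius for e, or there are counterexamples at every rate 2^-k,
   converging fast enough to do so almost everywhere. *)
have [[k hk]|nk] := pselect (exists k : nat, forall B, K B ->
    `|B - A| ^+ 2 <= 2^-1 ^+ k -> `|G B - G A| < e).
  have c0 : 0 < (2^-1 : R) ^+ k by rewrite exprn_gt0// invr_gt0.
  have c1 : (2^-1 : R) ^+ k <= 1 by rewrite exprn_ile1// ?invr_ge0// invf_le1 ?ler1n.
  near=> B => KB; rewrite distrC; apply: hk => //.
  have BA : `|B - A| < 2^-1 ^+ k.
    by rewrite distrC; near: B; apply: (@cvgr_dist_lt _ (L2 R d d d) _ _ _ id).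
  by rewrite expr2 (le_trans _ (ltW BA))// ler_piMl// (le_trans (ltW BA)).
have /choice[u uP] : forall k : nat, exists B,
    [/\ K B, `|B - A| ^+ 2 <= 2^-1 ^+ k & e <= `|G B - G A|].
  move=> k; apply: contrapT => nB; apply: nk; exists k => B KB BA.
  by rewrite ltNge; apply/negP => eB; apply: nB; exists B.
pose Q y := \sum_l dotp (cell_field (G A) l y) (cell_field (G A) l y).
have IQ : mu.-integrable setT (EFin \o Q).
  rewrite (_ : EFin \o Q = (fun y => \sum_l
      (dotp (cell_field (G A) l y) (cell_field (G A) l y))%:E)%E); last first.
    by apply/funext => y; rewrite /= sumEFin.
  by apply: integrable_sum => // l _; apply: integrable_dotp; exact: cell_field_mx.
have Q0 y : 0 <= Q y by apply: sumr_ge0 => l _; exact: dotp_ge0.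
pose f k y := frob (L2repr (u k) y - L2repr A y) * Q y.
(* Dominated convergence: two elliptic matrices have bounded distance, and [Q] is integrable. *)
have : (fun k => \int[mu]_y f k y) @ \oo --> 0.
  apply: (@dominated_cvg0_Rintegral _ _ _ _ _
      (fun y => ((beta + beta) ^+ 2 *+ d *+ d) * Q y)).
  - move=> k; apply: measurable_funM; last first.
      by apply/measurable_EFinP; exact: measurable_int IQ.
    exact: measurable_frob_dist.
  - exact: (integrableZl measurableT _ IQ).
  - have := L2_ae_cvg (fun k => let: And3 _ h _ := uP k in h).
    by apply: filterS => y fy; rewrite -[X in _ --> X](mul0r (Q y)); exact: cvgMr_tmp.
  - move=> k; have [/KP/(PDP _ alpha_gt0) Pk _ _] := uP k.
    move/KP/(PDP _ alpha_gt0): KA => PA; apply: filterS2 Pk PA => y eB eA.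
    by rewrite /f ger0_norm ?mulr_ge0 ?frob_ge0// ler_wpM2r// frob_elliptic_dist.
(* By stability every integral is at least alpha^2 e^2, against the limit 0. *)
have a2 : 0 < alpha ^+ 2 * e ^+ 2 by rewrite mulr_gt0 ?exprn_gt0.
move=> /cvgr_lt/(_ _ a2)[k _ /(_ k (leqnn k))] /=.
have [Kk _ ek] := uP k; rewrite ltNge => /negP; case.
apply: le_trans (cell_stability (KP _ KA) (KP _ Kk) (sG _ KA) (sG _ Kk)).
by rewrite ler_pM2l ?exprn_gt0// ler_sqr ?nnegrE// ltW.
Unshelve. all: by end_near. Qed.

End cell.

(** * Extension of the cell solution map *)

Theorem proposition1p2 (R : realType) (d : nat) (alpha beta : R)
    (alpha_gt0 : 0 < alpha) (alpha_le_beta : alpha <= beta)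
    (K : set (L2 R d d d)) (K_PD : K `<=` PD alpha beta)
    (K_closed : closed (K : set (subspace (PD alpha beta))))
    (G : K -> Hdot1 R d d)
    (G_cell : forall A : K, cell_solution (val A) (G A)) :
  exists Gext : L2 R d d d -> Hdot1 R d d,
    [/\ continuous Gext, bounded_fun Gext & forall A : K, Gext (val A) = G A].
Proof.
(* The value 0 off [K] only makes the map total; continuity is required within [K]. *)
pose G' A := if pselect (K A) is left KA then G (SigSub (mem_set KA)) else 0.
have G'E (A : K) : G' (val A) = G A.
  rewrite /G'; case: pselect => [KA|[]]; last exact: set_valP.
  by congr G; exact: val_inj.
have G'cell A : K A -> cell_solution A (G' A).
  move=> KA; have := G_cell (SigSub (mem_set KA)).
  by rewrite -G'E.
(* [K] is the trace on [PD] of a closed set V, and [PD] is itself closed in L^2. *)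
have cK : closed K.
  have /closed_subspaceP[V cV] := K_closed.
  rewrite (setIidl K_PD) => <-.
  by apply: closedI => //; exact: PD_closed.
have [F [cF FK Fb]] := dugundji cK (cell_continuous alpha_gt0 K_PD G'cell).
(* [cell_bound] solved for the norm of chi. The value does not depend on the coefficient, so it
   bounds the extension too. *)
pose M := Num.sqrt (beta ^+ 2 *+ d *+ d *+ d / alpha ^+ 2).
have hM A : K A -> `|G' A| <= M.
  move=> KA; have a2 : 0 < alpha ^+ 2 by rewrite exprn_gt0.
  rewrite -[leLHS]ger0_norm// -sqrtr_sqr ler_wsqrtr// ler_pdivlMr// mulrC.
  exact: cell_bound (K_PD _ KA) (G'cell _ KA).
exists F; split=> // [|A]; last by rewrite FK//; exact: set_valP.
exists M; split; first exact: num_real.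
by move=> c Mc x _; apply: (le_trans _ (ltW Mc)); apply: Fb; [exact: sqrtr_ge0|].
Qed.
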